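(* Let $\mathbb H$ be the sub-Finsler Heisenberg group, equipped with a strictly convex norm $\|\cdot\|$ on $\mathbb R^2$ which is not $C^1$, and let $\mathfrak m$ be a positive smooth measure on $\mathbb H$. Then the metric measure space $(\mathbb H,\mathsf d_{SF},\mathfrak m)$ does not satisfy the measure contraction property $\mathsf{MCP}(K,N)$ for any $K\in\mathbb R$ and $N\in(1,\infty)$.
   Context: **Sub-Finsler Heisenberg group.** $\mathbb H$ is $\mathbb R^3$ with group law $(x,y,z)\star(x',y',z')=(x+x',y+y',z+z'+\frac12(xy'-x'y))$ and left-invariant vector fields $X_1=\partial_x-\frac y2\partial_z$, $X_2=\partial_y+\frac x2\partial_z$. Given a (symmetric) norm $\|\cdot\|$ on $\mathbb R^2$, an admissible curve is an absolutely continuous $\gamma:[0,1]\to\mathbb H$ with $\dot\gamma(t)=u_1(t)X_1(\gamma(t))+u_2(t)X_2(\gamma(t))$ for a.e. $t$, for some $u=(u_1,u_2)\in L^2([0,1];\mathbb R^2)$; its length is $\int_0^1\|u(t)\|dt$, and $\mathsf d_{SF}(p,q)$ is the infimum of lengths of admissible curves from $p$ to $q$. The norm is strictly convex if $x\mapsto\|x\|^2$ is strictly convex (equivalently the unit ball is strictly convex); ''not $C^1$'' means $\|\cdot\|\notin C^1(\mathbb R^2\setminus\{0\})$. A positive smooth measure is a measure with smooth positive density with respect to Lebesgue measure. **Measure contraction property.** For a metric measure space $(\mathsf X,\mathsf d,\mathfrak m)$ (complete separable metric space with a locally finite Borel measure), $\mathrm{Geo}(\mathsf X)$ is the set of curves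 $\gamma:[0,1]\to\mathsf X$ with $\mathsf d(\gamma(s),\gamma(t))=|t-s|\,\mathsf d(\gamma(0),\gamma(1))$ and $e_t(\gamma)=\gamma(t)$. For $K\in\mathbb R$, $N>0$, $t\in[0,1]$, $\theta\ge0$ let $$\sigma^{(t)}_{K,N}(\theta)=\begin{cases}\frac{\sin(t\theta\sqrt{K/N})}{\sin(\theta\sqrt{K/N})}& N\pi^2>K\theta^2>0,\\ t& K\theta^2=0,\\ \frac{\sinh(t\theta\sqrt{-K/N})}{\sinh(\theta\sqrt{-K/N})}& K\theta^2<0,\end{cases}$$ with $\sigma^{(t)}_{K,N}(\theta)=+\infty$ if $K\theta^2\ge N\pi^2$, and for $N>1$ let $\tau^{(t)}_{K,N}(\theta)=t^{1/N}\big[\sigma^{(t)}_{K,N-1}(\theta)\big]^{1-1/N}$. The space satisfies $\mathsf{MCP}(K,N)$ if for every $x\in\mathrm{spt}(\mathfrak m)$ and every Borel set $A\subset\mathsf X$ with $0<\mathfrak m(A)<\infty$ there is a ($W_2$-)Wasserstein geodesic connecting $\delta_x$ and $\frac{\mathfrak m|_A}{\mathfrak m(A)}$, induced by some $\eta\in\mathscr P(\mathrm{Geo}(\mathsf X))$ (i.e. equal to $t\mapsto(e_t)_\#\eta$), such that for every $t\in[0,1]$ $$\frac1{\mathfrak m(A)}\,\mathfrak m\ \ge\ (e_t)_\#\Big(\tau^{(t)}_{K,N}\big(\mathsf d(\gamma(0),\gamma(1))\big)^N\,\eta(d\gamma)\Big).$$ *)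

(* Defs.v *)
From HB Require Import structures.
From mathcomp Require Import all_boot all_order all_algebra.
From mathcomp Require Import all_classical all_reals all_analysis.
From mathcomp Require Import ring.

Set Implicit Arguments.
Unset Strict Implicit.
Unset Printing Implicit Defensive.
Import Order.TTheory GRing.Theory Num.Theory.
Import numFieldNormedType.Exports.

Local Open Scope classical_set_scope.
Local Open Scope ring_scope.

(* [Ck k U f]: the real function f is of class C^k on the open set U.  On a
   finite-dimensional V, f is C^k.+1 on U iff it is differentiable on U and all
   its directional derivatives are C^k on U. *)
Fixpoint Ck (R : realType) (V : normedModType R) (k : nat) (U : set V)
    (f : V -> R) : Prop :=
  match k with
  | 0 => forall x, U x -> {for x, continuous f}
  | k'.+1 => (forall x, U x -> differentiable f x) /\
             (forall w : V, Ck k' U ('D_w f))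
  end.

Definition abs_continuous (R : realType) (V : normedModType R) (a b : R)
    (f : R -> V) : Prop :=
  forall e : R, 0 < e -> exists2 d : R, 0 < d &
    forall (n : nat) (s t : 'I_n -> R),
      (forall i, a <= s i /\ s i <= t i /\ t i <= b) ->
      (forall i j : 'I_n, (i < j)%N -> t i <= s j) ->
      \sum_i (t i - s i) < d -> \sum_i `|f (t i) - f (s i)| < e.

Section norms_on_the_plane.
Context (R : realType).

Definition is_norm (nrm : R * R -> R) : Prop :=
  [/\ forall v w, nrm (v + w) <= nrm v + nrm w,
      forall (a : R) v, nrm (a *: v) = `|a| * nrm v
    & forall v, nrm v = 0 -> v = 0].

Definition strictly_convex_norm (nrm : R * R -> R) : Prop :=
  forall (v w : R * R) (t : R), v != w -> 0 < t < 1 ->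
    nrm (t *: v + (1 - t) *: w) ^+ 2 <
      t * nrm v ^+ 2 + (1 - t) * nrm w ^+ 2.

Definition C1_norm (nrm : R * R -> R) : Prop := Ck 1 [set v | v != 0] nrm.

End norms_on_the_plane.

Notation heis R := (R * R * R)%type.

Section sub_Finsler_Heisenberg.
Context (R : realType).

Definition hmul (p q : heis R) : heis R :=
  let: (x, y, z) := p in let: (x', y', z') := q in
  (x + x', y + y', z + z' + (x * y' - x' * y) / 2).

Definition X1 (p : heis R) : heis R := (1, 0, - (p.1.2 / 2)).
Definition X2 (p : heis R) : heis R := (0, 1, p.1.1 / 2).

(* X1 and X2 generate the right translations by the first two coordinate axes,
   hence are left-invariant. *)
Lemma hmul_X1 (p : heis R) (h : R) : hmul p (h, 0, 0) = p + h *: X1 p.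
Proof.
case: p => -[x y] z; rewrite /hmul /X1 /=.
by congr (_, _, _) => /=; rewrite /GRing.scale /=; field.
Qed.

Lemma hmul_X2 (p : heis R) (h : R) : hmul p (0, h, 0) = p + h *: X2 p.
Proof.
case: p => -[x y] z; rewrite /hmul /X2 /=.
by congr (_, _, _) => /=; rewrite /GRing.scale /=; field.
Qed.

(* Only the values of g and u on [0, 1] matter. *)
Definition admissible (g : R -> heis R) (u : R -> R * R) : Prop :=
  [/\ abs_continuous 0 1 g,
      measurable_fun (`[0, 1] : set R) u,
      (\int[lebesgue_measure]_(t in `[0%R, 1%R])
          ((u t).1 ^+ 2 + (u t).2 ^+ 2)%:E < +oo)%E
    & {ae lebesgue_measure, forall t : R, t \in `[0, 1] ->
        is_derive t 1 g ((u t).1 *: X1 (g t) + (u t).2 *: X2 (g t))}].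

Definition sf_length (nrm : R * R -> R) (u : R -> R * R) : R :=
  \int[lebesgue_measure]_(t in `[0, 1]) nrm (u t).

Definition d_SF (nrm : R * R -> R) (p q : heis R) : R :=
  inf [set l | exists g u, [/\ admissible g u, g 0 = p, g 1 = q
                             & l = sf_length nrm u]].

(* [lebesgue_measure] lives on [measurableTypeR R], a copy of R carrying the same
   (convertible) measurable sets. *)
Definition lebesgue_heis : {measure set
    (measurableTypeR R * measurableTypeR R * measurableTypeR R) -> \bar R} :=
  (lebesgue_measure \x lebesgue_measure \x lebesgue_measure)%E.

(* d_SF induces the Euclidean topology, so that the measurable sets of the
   product R * R * R are the Borel sets of (heis R, d_SF). *)
Definition positive_smooth_measure (m : {measure set (heis R) -> \bar R}) :
    Prop :=
  exists rho : heis R -> R,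
    [/\ forall k, Ck k setT rho, forall p, 0 < rho p
      & forall B, measurable B ->
          m B = (\int[lebesgue_heis]_(p in B) (rho p)%:E)%E].

End sub_Finsler_Heisenberg.

Section distortion_coefficients.
Context (R : realType).

Definition sinh (x : R) : R := (expR x - expR (- x)) / 2.

Definition sigma (K N t theta : R) : \bar R :=
  if N * pi ^+ 2 <= K * theta ^+ 2 then +oo%E
  else if K * theta ^+ 2 == 0 then t%:E
  else if 0 < K * theta ^+ 2 then
    (sin (t * theta * Num.sqrt (K / N)) / sin (theta * Num.sqrt (K / N)))%:E
  else
    (sinh (t * theta * Num.sqrt (- K / N)) /
     sinh (theta * Num.sqrt (- K / N)))%:E.

(* When t = 0 and sigma = +oo, the library convention 0 * +oo = 0 applies. *)
Definition tau (K N t theta : R) : \bar R :=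
  ((t `^ N^-1)%:E * poweR (sigma K (N - 1) t theta) (1 - N^-1))%E.

End distortion_coefficients.

(* The metric measure space is given by a type T, a distance dist and a measure
   m; the sigma-algebra of T is meant to be the Borel one of dist. *)
Section measure_contraction_property.
Context (R : realType) (disp : measure_display) (T : measurableType disp).
Variable dist : T -> T -> R.

Notation curve := ({i01 R} -> T).

Definition Geo : set curve :=
  [set g | forall s t : {i01 R},
     dist (g s) (g t) = `|t%:num - s%:num| * dist (g 0%R%:i01) (g 1%R%:i01)].

Definition unif_open : set (set curve) :=
  [set U | forall g, U g -> exists2 e : R, 0 < e &
     forall h, (forall t, dist (g t) (h t) < e) -> U h].

(* All curves, with the Borel sigma-algebra of uniform convergence.  Borel
   probability measures on Geo are the probability measures on [curves] that
   give mass 1 to Geo. *)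
Definition curves := g_sigma_algebraType unif_open.

Definition ev (t : {i01 R}) (g : curves) : T := g t.

Definition coupling (mu nu : set T -> \bar R) (p : probability (T * T)%type R) :
    Prop :=
  forall B, measurable B -> p (B `*` setT) = mu B /\ p (setT `*` B) = nu B.

(* +oo is allowed; this happens when a second moment is infinite. *)
Definition W2 (mu nu : set T -> \bar R) : \bar R :=
  sqrte (ereal_inf
    [set c | exists2 p, coupling mu nu p
           & c = (\int[p]_z (dist z.1 z.2 ^+ 2)%:E)%E]).

Definition Wasserstein_geodesic (mu : {i01 R} -> set T -> \bar R) : Prop :=
  forall s t : {i01 R},
    W2 (mu s) (mu t) =
      (`|t%:num - s%:num|%:E * W2 (mu 0%R%:i01) (mu 1%R%:i01))%E.

Variable m : {measure set T -> \bar R}.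

Definition spt : set T :=
  [set x | forall r : R, 0 < r -> (0 < m [set y | dist x y < r]%R)%E].

Definition MCP (K N : R) : Prop :=
  forall (x : T) (A : set T), spt x -> measurable A -> (0 < m A < +oo)%E ->
  exists eta : probability curves R,
    [/\ eta Geo = 1%E,
        Wasserstein_geodesic (fun t => pushforward eta (ev t)),
        forall B, measurable B -> pushforward eta (ev 0%R%:i01) B = \d_x B,
        forall B, measurable B ->
          pushforward eta (ev 1%R%:i01) B = ((fine (m A))^-1%:E * m (A `&` B))%E
      & forall (t : {i01 R}) (B : set T), measurable B ->
          (\int[eta]_(g in ev t @^-1` B)
              poweR (tau K N t%:num (dist (g 0%R%:i01) (g 1%R%:i01))) N
            <= (fine (m A))^-1%:E * m B)%E].

End measure_contraction_property.

(* Main.v *)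
Require Import Defs.
From HB Require Import structures.
From mathcomp Require Import all_boot all_order all_algebra.
From mathcomp Require Import all_classical all_reals all_analysis.
From mathcomp Require Import measurable_realfun.
From mathcomp Require Import ring lra.
Import Order.TTheory GRing.Theory Num.Theory.
Import numFieldNormedType.Exports.
Set Implicit Arguments.
Unset Strict Implicit.
Unset Printing Implicit Defensive.
Local Open Scope classical_set_scope.
Local Open Scope ring_scope.

(* A norm that is not C^1 has a kink: there are a unit vector v, a transverse w
   with wedge v w = 1 and b > 0 such that nrm (x v + y w) >= |x| + b |y|, while
   nrm (v + s w) <= 1 + b s + o(s) for some arbitrarily small s > 0.  Let x, y
   be the coordinates of the projection of q in the basis (v, w), and let
   a = x y / 2 - z, the area below the projected curve.  If y, a > 0 are small
   with y^2 << a << y, a suitable curve with two sides, the first along v, shows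
   that d(0, q) <= x + b y + O(a).  Calibrating with the covector field
   (1, b (1 - l + x)), which lies in the dual ball along curves of length l,
   shows that for a midpoint of 0 and such a q both y and a are bounded by a
   multiple of the a of q.  Hence the points with x in a fixed interval, y in
   (y0, 2 y0) and a in (a0, 2 a0) have their midpoints in a box of size O(a0)
   in both transverse directions.  The ratio O(a0^2 / (y0 a0)) of the volumes
   tends to 0, contradicting MCP at time 1/2. *)

(** * Kinks of planar norms *)

(** The calibration reflects how extremals behave at a kink. The segment [{1} x [-b, b]] lies in the
    boundary of the dual ball, and each of its covectors is normed by [v]. While a curve runs along
    [v], its covector [(1, be + c x)] moves along this segment at constant speed [c], and the curve
    does not turn before the covector reaches an end. Geodesics to many endpoints therefore share a
    long initial stretch along [v]. With [c = b] the segment, of length [2 b], is crossed while [x]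
    runs over an interval of length 2. On a curve of length [l], [x] stays in [[-l, l]], so [l <= 1]
    is required. Hence the scale: [q] has [x] near 9/8, which puts each half, of length about 9/16,
    within reach of the calibration. Applied to both halves, the calibration says that the area
    below each of them is nonnegative up to a small error. The total area [a] also contains the
    rectangle of height [Y] below the second half, where [Y] is the height of the midpoint. The
    width of this rectangle is bounded below, so [Y] is controlled by [a], although [y] is much
    larger than [a]. *)

Section kink.
Context (R : realType).
Implicit Types (v w u : R * R).

Definition wedge v w : R := v.1 * w.2 - v.2 * w.1.

Lemma wedgeDr u v w : wedge u (v + w) = wedge u v + wedge u w.
Proof. rewrite /wedge /=; ring. Qed.

Lemma wedgeDl u v w : wedge (u + v) w = wedge u w + wedge v w.
Proof. rewrite /wedge /=; ring. Qed.

Lemma wedgeZr a v w : wedge v (a *: w) = a * wedge v w.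
Proof. rewrite /wedge /= /GRing.scale /=; ring. Qed.

Lemma wedgeZl a v w : wedge (a *: v) w = a * wedge v w.
Proof. rewrite /wedge /= /GRing.scale /=; ring. Qed.

Lemma wedgevv v : wedge v v = 0.
Proof. rewrite /wedge; ring. Qed.

Lemma scale_shear v w (x y c : R) :
  x *: v + y *: (w - c *: v) = (x - c * y) *: v + y *: w.
Proof. by rewrite scalerBr scalerA scalerBl [y * c]mulrC addrA addrAC. Qed.

Lemma wedge_decomp v w u : wedge v w = 1 -> u = wedge u w *: v + wedge v u *: w.
Proof.
case: v w u => [a b] [c d] [x y]; rewrite /wedge /= => h.
have e : d * a - b * c = 1 by rewrite -h; ring.
congr (_, _); rewrite /= /GRing.scale /=.
  rewrite -[LHS]mul1r -e; ring.
rewrite -[LHS]mul1r -e; ring.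
Qed.

Lemma differentiable_of_little_o (V W : normedModType R) (f : V -> W) (x : V)
    (L : {linear V -> W}) : continuous L ->
  (forall e, 0 < e -> \forall h \near (0 : V), `|f (h + x) - f x - L h| <= e * `|h|) ->
  differentiable f x.
Proof.
move=> cL H.
have fE : f \o shift x = cst (f x) + L +o_ 0 id.
  apply/eqaddoE/eqaddoP => e e0.
  by apply: filterS (H e e0) => h /=; rewrite opprD addrA.
by apply/diff_locallyP; rewrite (diff_unique cL fE); split.
Qed.

Lemma differentiable_planar (f : R * R -> R) (x : R * R) (a b : R) :
  (forall e, 0 < e -> \forall h \near (0 : R * R),
     `|f (h + x) - f x - (a * h.1 + b * h.2)| <= e * `|h|) ->
  differentiable f x.
Proof.
move=> H; pose L (h : R * R) : R := a * h.1 + b * h.2.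
have linL : linear L.
  by move=> k u v; rewrite /L /= /GRing.scale /=; ring.
pose LM := GRing.isLinear.Build _ _ _ _ _ linL.
pose LL : {linear _ -> _} := HB.pack L LM.
apply: (@differentiable_of_little_o _ _ _ _ LL) => // u.
by apply: cvgD; apply: cvgMr; [exact: cvg_fst|exact: cvg_snd].
Qed.

Context (nrm : R * R -> R).
Hypothesis nrmN : is_norm nrm.

Let nrmD v w : nrm (v + w) <= nrm v + nrm w. Proof. by case: nrmN. Qed.
Let nrmZ a v : nrm (a *: v) = `|a| * nrm v. Proof. by case: nrmN. Qed.

Lemma norm0 : nrm 0 = 0.
Proof. by rewrite -[X in nrm X](scale0r (0 : R * R)) nrmZ normr0 mul0r. Qed.

Lemma normN v : nrm (- v) = nrm v.
Proof. by rewrite -scaleN1r nrmZ normrN1 mul1r. Qed.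

Lemma norm_ge0 v : 0 <= nrm v.
Proof. have := nrmD v (- v); rewrite subrr norm0 normN; lra. Qed.

Lemma norm_gt0 v : v != 0 -> 0 < nrm v.
Proof.
move=> v0; rewrite lt_neqAle norm_ge0 andbT eq_sym; apply: contra v0.
by case: nrmN => _ _ h /eqP /h ->.
Qed.

Lemma norm_distr v w : `|nrm v - nrm w| <= nrm (v - w).
Proof.
have h1 := nrmD (v - w) w; have h2 := nrmD (w - v) v.
rewrite !subrK in h1 h2.
by rewrite ler_norml -(opprB v w) normN in h2 *; apply/andP; split; lra.
Qed.

Let C := nrm (1, 0) + nrm (0, 1).

Lemma norm_le_sum v : nrm v <= C * `|v|.
Proof.
have {1}-> : v = v.1 *: (1, 0) + v.2 *: (0, 1).
  by case: v => a b; congr (_, _); rewrite /= /GRing.scale /=; ring.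
apply: (le_trans (nrmD _ _)); rewrite !nrmZ.
have h1 : `|v.1| <= `|v| by rewrite prod_normE le_max lexx.
have h2 : `|v.2| <= `|v| by rewrite prod_normE le_max lexx orbT.
have := ler_wpM2r (norm_ge0 (1, 0)) h1; have := ler_wpM2r (norm_ge0 (0, 1)) h2.
rewrite /C; lra.
Qed.

Lemma norm_lipschitz : exists2 K : R, 0 < K &
  forall v w, `|nrm v - nrm w| <= K * `|v - w|.
Proof.
exists (C + 1) => [|v w].
  by have := norm_ge0 (1, 0); have := norm_ge0 (0, 1); rewrite /C; lra.
apply: (le_trans (norm_distr v w)); apply: (le_trans (norm_le_sum _)).
by rewrite ler_wpM2r ?lerDl.
Qed.

Lemma norm_continuous : continuous nrm.
Proof.
have [K K0 hK] := norm_lipschitz => v.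
apply/cvgrPdist_lt => e e0; near=> w.
apply: (le_lt_trans (hK _ _)); rewrite -ltr_pdivlMl // .
near: w; apply: cvgr_dist_lt => //; rewrite mulr_gt0 ?invr_gt0 //.
Unshelve. all: by end_near.
Qed.

Definition slope v w s : R := (nrm (v + s *: w) - nrm v) / s.

Lemma norm_convex v w t : 0 <= t -> t <= 1 ->
  nrm ((1 - t) *: v + t *: w) <= (1 - t) * nrm v + t * nrm w.
Proof.
move=> t0 t1; apply: (le_trans (nrmD _ _)); rewrite !nrmZ !ger0_norm //; lra.
Qed.

Lemma slope_le v w (s t : R) : 0 < s -> s <= t -> slope v w s <= slope v w t.
Proof.
move=> s0 st; have t0 : 0 < t := lt_le_trans s0 st.
have := @norm_convex v (v + t *: w) (s / t).
have -> : (1 - s / t) *: v + (s / t) *: (v + t *: w) = v + s *: w.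
  rewrite scalerDr scalerA divfK ?gt_eqF // addrA -scalerDl.
  by rewrite subrK scale1r.
move=> /(_ (divr_ge0 (ltW s0) (ltW t0))); rewrite ler_pdivrMr // mul1r => /(_ st) h.
rewrite /slope ler_pdivrMr // mulrAC ler_pdivlMr //.
move: h; rewrite -(ler_pM2r t0).
have -> : ((1 - s / t) * nrm v + s / t * nrm (v + t *: w)) * t =
  (t - s) * nrm v + s * nrm (v + t *: w).
  by field; rewrite gt_eqF.
lra.
Qed.

Lemma slope_opp_le v w (s t : R) : 0 < s -> 0 < t -> - slope v (- w) s <= slope v w t.
Proof.
move=> s0 t0; have st : 0 < s + t by rewrite addr_gt0.
have := @norm_convex (v - s *: w) (v + t *: w) (s / (s + t)).
have -> : (1 - s / (s + t)) *: (v - s *: w) + (s / (s + t)) *: (v + t *: w) = v.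
  rewrite !scalerDr !scalerN !scalerA addrACA -scalerDl subrK scale1r.
  rewrite -scaleNr -scalerDl [X in X *: w](_ : _ = 0) ?scale0r ?addr0 //.
  by field; rewrite gt_eqF.
move=> /(_ (divr_ge0 (ltW s0) (ltW st))).
rewrite ler_pdivrMr // mul1r lerDl => /(_ (ltW t0)) h.
rewrite /slope scalerN -mulNr ler_pdivrMr // mulrAC ler_pdivlMr //.
move: h; rewrite -(ler_pM2r st).
have -> : ((1 - s / (s + t)) * nrm (v - s *: w) + s / (s + t) * nrm (v + t *: w)) * (s + t) =
  t * nrm (v - s *: w) + s * nrm (v + t *: w).
  by field; rewrite gt_eqF.
lra.
Qed.

(** The right derivative of [nrm] at [v] along [w]. By convexity the slopes are nondecreasing in
    [s], so the limit at 0+ is an infimum and always exists. *)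
Definition rslope v w : R := inf [set slope v w s | s in [set s | 0 < s]].

Let slope_has_inf v w : has_inf [set slope v w s | s in [set s | 0 < s]].
Proof.
split; first by exists (slope v w 1), 1 => //=.
by exists (- slope v (- w) 1) => _ [s /= s0 <-]; apply: slope_opp_le.
Qed.

Lemma rslope_le v w s : 0 < s -> rslope v w <= slope v w s.
Proof. by move=> s0; apply: ge_inf; [case: (slope_has_inf v w)|exists s]. Qed.

Lemma rslope_approx v w e : 0 < e ->
  exists2 s0, 0 < s0 & forall s, 0 < s -> s <= s0 -> slope v w s < rslope v w + e.
Proof.
move=> e0; have [_ [s0 /= s00 <-] h] := inf_adherent e0 (slope_has_inf v w).
by exists s0 => // s sp ss; apply: le_lt_trans h; apply: slope_le.
Qed.

Lemma rslope_opp v w : - rslope v (- w) <= rslope v w.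
Proof.
apply: lb_le_inf; first by exists (slope v w 1), 1 => //=.
move=> _ [t /= t0 <-]; rewrite lerNl.
apply: lb_le_inf; first by exists (slope v (- w) 1), 1 => //=.
by move=> _ [s /= s0 <-]; rewrite lerNl; apply: slope_opp_le.
Qed.

(** Every value between the left and the right derivative gives a subgradient [(1, b)] of the norm
    at [v]. *)
Lemma rslope_supports v w : nrm v = 1 -> forall b, - rslope v (- w) <= b ->
  b <= rslope v w -> forall x y, x + b * y <= nrm (x *: v + y *: w).
Proof.
move=> v1 b b1 b2.
have pos x y : 0 < x -> x + b * y <= nrm (x *: v + y *: w).
  move=> x0; have -> : x *: v + y *: w = x *: (v + (y / x) *: w).
    by rewrite scalerDr scalerA mulrC divfK ?gt_eqF.
  rewrite nrmZ gtr0_norm // -ler_pdivrMl //.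
  have -> : x^-1 * (x + b * y) = 1 + b * (y / x) by field; rewrite gt_eqF.
  have [s0|s0|<-] := ltgtP 0 (y / x); last by rewrite scale0r addr0 v1 mulr0 addr0.
    have := le_trans b2 (rslope_le v w s0).
    by rewrite /slope v1 ler_pdivlMr //; lra.
  have s0' : 0 < - (y / x) by lra.
  have := rslope_le v (- w) s0'.
  rewrite /slope v1 ler_pdivlMr // scalerN scaleNr opprK.
  move: b1; rewrite lerNl => b1; have := ler_wpM2r (ltW s0') b1; lra.
(* For the other [x], adding [k v] makes the first coordinate positive, adds [k] to the left side
   and at most [k] to the norm. *)
move=> x y; set k := `|x| + 1.
have k0 : 0 < k by rewrite /k ltr_wpDl.
have xk : 0 < x + k by have := ler_norm (- x); rewrite normrN /k; lra.
have := nrmD (x *: v + y *: w) (k *: v).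
rewrite nrmZ v1 (gtr0_norm k0) addrAC -scalerDl.
have := pos (x + k) y xk; lra.
Qed.

Definition has_kink := exists v w d, [/\ v != 0, 0 < d &
  d <= rslope v w + rslope v (- w)].

(** For a fixed step [s] the slope is continuous in the base point. The infimum [rslope] thereby
    becomes upper semicontinuous in it. *)
Lemma slope_lipschitz v w : exists2 K, 0 < K &
  forall u s, 0 < s -> `|slope u w s - slope v w s| <= K * `|u - v| / s.
Proof.
have [K K0 hK] := norm_lipschitz; exists (K + K); first by rewrite addr_gt0.
move=> u s s0; rewrite /slope -mulrBl normrM normfV (gtr0_norm s0).
rewrite ler_pM2r ?invr_gt0 //.
have -> : nrm (u + s *: w) - nrm u - (nrm (v + s *: w) - nrm v) =
  (nrm (u + s *: w) - nrm (v + s *: w)) - (nrm u - nrm v) by ring.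
apply: (le_trans (ler_normB _ _)); rewrite mulrDl lerD //.
by apply: (le_trans (hK _ _)); rewrite opprD addrACA subrr addr0.
Qed.

Lemma slope_derive v w : rslope v w + rslope v (- w) = 0 ->
  is_derive v w nrm (rslope v w).
Proof.
move=> h; have cv : h^-1 *: ((nrm \o shift v) (h *: w) - nrm v) @[h --> 0^'] --> rslope v w.
  apply/cvgrPdist_lt => e e0.
  have [s1 s10 h1] := rslope_approx v w e0.
  have [s2 s20 h2] := rslope_approx v (- w) e0.
  exists (Num.min s1 s2) => /=; first by rewrite lt_min s10 s20.
  move=> t; rewrite /= sub0r normrN lt_min => /andP[t1 t2] tn0.
  have [t0|t0|t0] := ltgtP 0 t; last by rewrite t0 eqxx in tn0.
    rewrite (gtr0_norm t0) in t1 t2.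
    have := h1 t t0 (ltW t1); have := rslope_le v w t0.
    rewrite /slope [v + _]addrC ![_ / t]mulrC /GRing.scale /= => *.
    by rewrite ltr_norml; apply/andP; split; lra.
  rewrite (ltr0_norm t0) in t1 t2; have t0' : 0 < - t by lra.
  have := h2 _ t0' (ltW t2); have := rslope_le v (- w) t0'.
  rewrite /slope scalerN scaleNr opprK invrN mulrN [v + _]addrC ![_ / t]mulrC.
  rewrite /GRing.scale /= => *.
  by rewrite ltr_norml; apply/andP; split; lra.
split; first by apply/cvg_ex; exists (rslope v w).
exact/cvg_lim.
Qed.

(** Without a kink the one-sided derivatives along [w] and [- w] are opposite. Both are upper
    semicontinuous in the base point, hence continuous. Differentiability reduces by homogeneity to
    a single derivative, along a direction transverse to [v]. *)
Lemma no_kink_C1 : ~ has_kink -> C1_norm nrm.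
Proof.
move=> nk; have flat v w : v != 0 -> rslope v w + rslope v (- w) = 0.
  move=> v0; apply/eqP; rewrite eq_le; apply/andP; split; last first.
    by have := rslope_opp v w; lra.
  by rewrite leNgt; apply/negP => h; apply: nk; exists v, w, (rslope v w + rslope v (- w)).
split; last first.
  move=> w v /= v0; have der u : u != 0 -> 'D_w nrm u = rslope u w.
    by move=> u0; have [] := slope_derive (flat u w u0).
  have [K K0 hK] := slope_lipschitz v w.
  have [K' K'0 hK'] := slope_lipschitz v (- w).
  apply/cvgrPdist_lt => e e0; rewrite /= der //.
  have e2 : 0 < e / 2 by rewrite divr_gt0.
  (* One step size is fixed at which the slope at [v] is within [e / 2] of its limit. For [u] near
     [v] the slope with the same step bounds [rslope u w] from above. The step along [- w] gives the
     lower bound through [flat]. *)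
  have [s s0 /(_ s s0 (lexx _)) hs] := rslope_approx v w e2.
  have [s' s'0 /(_ s' s'0 (lexx _)) hs'] := rslope_approx v (- w) e2.
  have v0' : 0 < `|v| by rewrite normr_gt0.
  near=> u.
  have u0 : u != 0.
    apply: contraTN (_ : `|v - u| < `|v|) => [/eqP ->|]; first by rewrite subr0 ltxx.
    by near: u; apply: cvgr_dist_lt.
  have h1 : K * `|u - v| / s < e / 2.
    rewrite ltr_pdivrMr // -ltr_pdivlMl // distrC.
    by near: u; apply: cvgr_dist_lt => //; rewrite !mulr_gt0 ?invr_gt0.
  have h2 : K' * `|u - v| / s' < e / 2.
    rewrite ltr_pdivrMr // -ltr_pdivlMl // distrC.
    by near: u; apply: cvgr_dist_lt => //; rewrite !mulr_gt0 ?invr_gt0.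
  rewrite der //.
  have := rslope_le u w s0; have := rslope_le u (- w) s'0.
  have := hK u s s0; have := hK' u s' s'0; rewrite !ler_norml => /andP[] + + /andP[].
  have := flat u w u0; have := flat v w v0.
  by rewrite ltr_norml; clear -hs hs' h1 h2 nrmN => *; apply/andP; split; lra.
move=> v /= v0; pose J : R * R := (- v.2, v.1).
have N0 : 0 < v.1 ^+ 2 + v.2 ^+ 2.
  rewrite lt_neqAle addr_ge0 ?sqr_ge0 // andbT eq_sym paddr_eq0 ?sqr_ge0 //.
  rewrite !sqrf_eq0; apply: contra v0 => /andP[/eqP v1 /eqP v2].
  by rewrite [v]surjective_pairing v1 v2.
set N := _ + _ in N0; pose p := rslope v J.
pose X (h : R * R) := (h.1 * v.1 + h.2 * v.2) / N.
pose Y (h : R * R) := (v.1 * h.2 - v.2 * h.1) / N.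
have dec h : h = X h *: v + Y h *: J.
  case: h => a b; rewrite /X /Y /J /N /= in N0 *.
  by congr (_, _); rewrite /= /GRing.scale /=; field; rewrite gt_eqF.
(* The candidate differential is [X h * nrm v + Y h * p]: the derivative along [v] is [nrm v] by
   homogeneity, the one along [J] is [p]. *)
apply: (@differentiable_planar _ _ (v.1 / N * nrm v - v.2 / N * p)
  (v.2 / N * nrm v + v.1 / N * p)) => e e0.
pose M := (`|v.1| + `|v.2|) / N.
have M0 : 0 <= M by apply: divr_ge0; [exact: addr_ge0|exact: ltW].
have XM h : `|X h| <= M * `|h|.
  rewrite /X /M normrM normfV (gtr0_norm N0) mulrAC ler_pM2r ?invr_gt0 //.
  apply: (le_trans (ler_normD _ _)); rewrite mulrDl !normrM.
  by rewrite lerD // mulrC ler_wpM2l // prod_normE le_max lexx ?orbT.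
have YM h : `|Y h| <= M * `|h|.
  rewrite /Y /M normrM normfV (gtr0_norm N0) mulrAC ler_pM2r ?invr_gt0 //.
  apply: (le_trans (ler_normB _ _)); rewrite mulrDl !normrM.
  by rewrite lerD // ler_wpM2l // prod_normE le_max lexx ?orbT.
pose e' := e / (M + 1); have e'0 : 0 < e' by rewrite divr_gt0 // ltr_wpDl.
have [s1 s10 h1] := rslope_approx v J e'0.
have [s2 s20 h2] := rslope_approx v (- J) e'0.
(* This radius ensures [|X h| < 1 / 2] and [2 |Y h| < min s1 s2], so that [s = Y h / (1 + X h)]
   below is within the range of [h1] and [h2]. *)
pose r := Num.min (1 / 2) (Num.min s1 s2 / 2) / (M + 1).
have r0 : 0 < r by rewrite divr_gt0 ?lt_min ?divr_gt0 ?lt_min ?s10 ?s20 // ltr_wpDl.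
near=> h; have hr : `|h| < r.
  by rewrite -normrN -sub0r; near: h; apply: cvgr_dist_lt.
have Mh : M * `|h| < Num.min (1 / 2) (Num.min s1 s2 / 2).
  move: hr; rewrite /r ltr_pdivlMr ?ltr_wpDl // mulrDr mulr1 [`|h| * M]mulrC.
  by apply: le_lt_trans; rewrite lerDl.
have := le_lt_trans (XM h) Mh; have := le_lt_trans (YM h) Mh.
rewrite !lt_min => /andP[_ Ys] /andP[X2 _].
rewrite ltr_pdivlMr // lt_min in Ys.
have X1 : 1 / 2 < 1 + X h by move: X2; rewrite ltr_norml => /andP[]; lra.
have X10 : 0 < 1 + X h by lra.
have -> : h + v = (1 + X h) *: (v + (Y h / (1 + X h)) *: J).
  rewrite scalerDr scalerA [(1 + X h) * _]mulrC divfK ?gt_eqF //.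
  by rewrite scalerDl scale1r {1}(dec h) addrC addrA.
rewrite nrmZ (gtr0_norm X10).
have -> : (1 + X h) * nrm (v + (Y h / (1 + X h)) *: J) - nrm v -
  ((v.1 / N * nrm v - v.2 / N * p) * h.1 + (v.2 / N * nrm v + v.1 / N * p) * h.2)
  = (1 + X h) * (nrm (v + (Y h / (1 + X h)) *: J) - nrm v) - p * Y h.
  by rewrite /X /Y; field; rewrite gt_eqF.
have eM : e' * `|Y h| <= e * `|h|.
  apply: (@le_trans _ _ (e' * ((M + 1) * `|h|))); last first.
    by rewrite mulrA divfK // gt_eqF // ltr_wpDl.
  by rewrite ler_pM2l // (le_trans (YM h)) // ler_wpM2r // lerDl.
apply: le_trans eM; set s := Y h / (1 + X h).
have Ysx : Y h = s * (1 + X h) by rewrite divfK ?gt_eqF.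
clearbody s.
have sn : `|s| <= 2 * `|Y h|.
  rewrite Ysx normrM (gtr0_norm X10) mulrCA ler_peMr //; lra.
have fl := flat v J v0.
have [s0|s0|s0] := ltgtP 0 s.
- rewrite (gtr0_norm s0) in sn.
  have ss1 : s <= s1 by move/andP: Ys => []; lra.
  have := h1 s s0 ss1; have := rslope_le v J s0; rewrite -/p => h3 h4.
  have -> : nrm (v + s *: J) - nrm v = slope v J s * s by rewrite /slope divfK ?gt_eqF.
  rewrite Ysx mulrCA [(1 + X h) * s]mulrC mulrA -mulrA -mulrBl normrM.
  rewrite [`|s * _|]gtr0_norm ?mulr_gt0 // ler_pM2r ?mulr_gt0 //.
  by rewrite ler_norml; apply/andP; split; lra.
- have s0' : 0 < - s by lra.
  rewrite (ltr0_norm s0) in sn.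
  have ss1 : - s <= s2 by move/andP: Ys => []; lra.
  have := h2 _ s0' ss1; have := rslope_le v (- J) s0' => h3 h4.
  have -> : nrm (v + s *: J) - nrm v = slope v (- J) (- s) * (- s).
    by rewrite /slope divfK ?gt_eqF // scalerN scaleNr opprK.
  have -> : (1 + X h) * (slope v (- J) (- s) * - s) - p * Y h =
    (slope v (- J) (- s) + p) * (- s * (1 + X h)) by rewrite Ysx; ring.
  rewrite Ysx -[`|s * _|]normrN -mulNr normrM.
  rewrite [`|- s * _|]gtr0_norm ?mulr_gt0 // ler_pM2r ?mulr_gt0 //.
  by rewrite ler_norml /p; apply/andP; split; lra.
- by rewrite Ysx -s0 mul0r scale0r addr0 subrr !mulr0 subrr normr0 mulr0.
Unshelve. all: by end_near.
Qed.

Lemma rslope_scale v w (c e : R) : 0 < c -> 0 < e ->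
  e * rslope v w <= rslope (c *: v) (e *: w).
Proof.
move=> c0 e0; apply: lb_le_inf; first by exists (slope (c *: v) (e *: w) 1), 1 => //=.
move=> _ [s /= s0 <-]; have t0 : 0 < s * e / c by rewrite divr_gt0 ?mulr_gt0.
apply: (@le_trans _ _ (e * slope v w (s * e / c))).
  by rewrite ler_pM2l //; apply: rslope_le.
rewrite /slope (_ : c *: v + s *: (e *: w) = c *: (v + (s * e / c) *: w)).
  rewrite !nrmZ (gtr0_norm c0) le_eqVlt; apply/orP; left; apply/eqP.
  by field; rewrite !gt_eqF.
by rewrite scalerDr !scalerA [c * _]mulrC divfK ?gt_eqF.
Qed.

(** Replacing [w1] by [w1 - c v] lowers the slope along it by [c] and raises the opposite slope by
    [c]. With [c] half their difference, both become [b], half their sum. *)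
Lemma kink_normal_form : has_kink -> exists v w b,
  [/\ 0 < b, nrm v = 1, wedge v w = 1,
      forall u, `|wedge u w| + b * `|wedge v u| <= nrm u
    & forall k, 0 < k -> exists s, [/\ 0 < s, s <= k &
        nrm (v + s *: w) <= 1 + b * s + k * s]].
Proof.
move=> [v0 [w0 [d0 [v00 d00 kink0]]]].
have [v [w1 [vn vw kink]]] : exists v w, [/\ nrm v = 1, wedge v w = 1 &
    0 < rslope v w + rslope v (- w)].
  have nv := norm_gt0 v00.
  (* Along a multiple of [v0] the norm is affine near [v0], so the two slopes would cancel. *)
  have par : wedge v0 w0 != 0.
    apply/eqP => par; have : exists c, w0 = c *: v0.
      have [h|h] := eqVneq v0.1 0.
        have h2 : v0.2 != 0.
          by apply: contra v00 => /eqP h2; rewrite [v0]surjective_pairing h h2.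
        exists (w0.2 / v0.2); move: par; rewrite /wedge h mul0r sub0r => /eqP.
        rewrite oppr_eq0 mulf_eq0 (negbTE h2) /= => /eqP w1.
        case: (w0) w1 => a c /= ->; case: (v0) h h2 => a' c' /= -> h2.
        by congr (_, _); rewrite /= /GRing.scale /= ?mulr0 // divfK.
      exists (w0.1 / v0.1); move: par; rewrite /wedge.
      case: (v0) h => a c /= a0; case: (w0) => a' c' /= h.
      congr (_, _); rewrite /= /GRing.scale /= ?divfK //.
      by apply: (mulfI a0); rewrite (_ : a * c' = c * a'); [field|lra].
    move=> [c wc].
    pose s := (`|c| + 1)^-1; have s0 : 0 < s by rewrite invr_gt0 ltr_wpDl.
    have cs : `|c * s| <= 1.
      by rewrite normrM (gtr0_norm s0) ler_pdivrMr ?ltr_wpDl // mul1r lerDl.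
    have := rslope_le v0 w0 s0; have := rslope_le v0 (- w0) s0.
    have key a : `|a * s| <= 1 -> nrm (v0 + s *: (a *: v0)) = (1 + a * s) * nrm v0.
      rewrite ler_norml => /andP[a1 a2].
      by rewrite scalerA -[X in X + _ *: _]scale1r -scalerDl nrmZ ger0_norm; lra.
    have cs' : `|- c * s| <= 1 by rewrite mulNr normrN.
    have e1 := key c cs; have e2 := key (- c) cs'.
    rewrite scaleNr -wc in e2; rewrite -wc in e1.
    rewrite /slope e1 e2 !ler_pdivlMr // => h1 h2.
    have : (rslope v0 w0 + rslope v0 (- w0)) * s <= 0 by lra.
    rewrite pmulr_lle0 //; lra.
  wlog par0 : w0 kink0 par / 0 < wedge v0 w0.
    move=> H; move: (par); rewrite neq_lt => /orP[h|h]; last exact: (H w0).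
    have e : wedge v0 (- w0) = - wedge v0 w0 by rewrite -scaleN1r wedgeZr mulN1r.
    by apply: (H (- w0)); rewrite ?opprK ?e; lra.
  exists ((nrm v0)^-1 *: v0), ((nrm v0 / wedge v0 w0) *: w0); split.
  - by rewrite nrmZ gtr0_norm ?invr_gt0 // mulVf ?gt_eqF.
  - by rewrite wedgeZl wedgeZr; field; rewrite par gt_eqF.
  have c0 : 0 < (nrm v0)^-1 by rewrite invr_gt0.
  have e0 : 0 < nrm v0 / wedge v0 w0 by rewrite divr_gt0.
  rewrite -scalerN.
  have := rslope_scale v0 w0 c0 e0; have := rslope_scale v0 (- w0) c0 e0.
  have := mulr_gt0 e0 (lt_le_trans d00 kink0); lra.
pose p := rslope v w1; pose q := rslope v (- w1); rewrite -/p -/q in kink.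
pose b := (p + q) / 2; pose c := (p - q) / 2; pose w := w1 - c *: v.
have vw2 : wedge v w = 1.
  by rewrite /w -scaleNr wedgeDr wedgeZr wedgevv mulr0 addr0.
have lowe u : wedge u w + b * `|wedge v u| <= nrm u.
  rewrite {3}(wedge_decomp u vw2); set x := wedge u w; set y := wedge v u.
  have -> : x *: v + y *: w = (x - c * y) *: v + y *: w1.
    exact: scale_shear.
  have q1 : - q <= p by lra.
  have h1 := rslope_supports vn (lexx _ : - rslope v (- w1) <= - q) q1 (x - c * y) y.
  have h2 := rslope_supports vn q1 (lexx p) (x - c * y) y.
  have [y0|y0] := ger0P y; rewrite ?(ger0_norm y0) ?(ltr0_norm y0).
    by apply: le_trans h2; rewrite /b /c; lra.
  by apply: le_trans h1; rewrite /b /c; lra.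
exists v, w, b; split => //; first by rewrite divr_gt0.
  (* The bound for [- u] supplies the case of a negative first coordinate. *)
  move=> u; have h1 := lowe u; have := lowe (- u); rewrite normN.
  rewrite -scaleN1r wedgeZl wedgeZr !mulN1r normrN => h2.
  have [x0|x0] := ger0P (wedge u w); lra.
move=> k k0; have [s0 s00 hs] := rslope_approx v w1 k0.
(* In the sheared basis [v + m w1 = (1 + c m) (v + s w)] with [s = m / (1 + c m)]. The bound
   [|c m| <= 1 / 2] gives [s <= 2 m <= k]. *)
pose m := Num.min s0 (Num.min (k / 2) ((2 * (`|c| + 1))^-1)).
have c1 : 0 < `|c| + 1 by rewrite ltr_wpDl.
have m0 : 0 < m by rewrite !lt_min s00 divr_gt0 // invr_gt0 mulr_gt0.
have /(_ m m0) := hs; rewrite {1}/m ge_min lexx => /(_ isT) hm.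
have mk : m <= k / 2 by rewrite /m !ge_min lexx orbT.
have cm : `|c * m| <= 1 / 2.
  rewrite normrM (gtr0_norm m0).
  apply: (@le_trans _ _ (`|c| * (2 * (`|c| + 1))^-1)).
    by rewrite ler_wpM2l // /m !ge_min lexx !orbT.
  by rewrite ler_pdivrMr ?mulr_gt0 //; lra.
have cm1 : 1 / 2 <= 1 + c * m by move: cm; rewrite ler_norml => /andP[]; lra.
have cm0 : 0 < 1 + c * m by lra.
exists (m / (1 + c * m)); split.
- by rewrite divr_gt0.
- rewrite ler_pdivrMr //; have := ler_wpM2l (ltW k0) cm1; lra.
have -> : v + (m / (1 + c * m)) *: w = (1 + c * m)^-1 *: (v + m *: w1).
  rewrite -[X in X + _]scale1r scale_shear [in RHS]scalerDr scalerA [m / _]mulrC.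
  by congr (_ *: _ + _); field; rewrite gt_eqF.
rewrite nrmZ gtr0_norm ?invr_gt0 // ler_pdivrMl //.
have -> : (1 + c * m) * (1 + b * (m / (1 + c * m)) + k * (m / (1 + c * m))) =
  1 + (c + b + k) * m by field; rewrite gt_eqF.
have -> : c + b = p by rewrite /c /b; field.
by move: hm; rewrite /slope vn ltr_pdivrMr // -/p; lra.
Qed.

End kink.

(** * Absolutely continuous functions and measurability *)

Section absolute_continuity.
Context (R : realType).
Local Notation mu := (@lebesgue_measure R).

(** Only a decrease of [N - h] has to be excluded, so [N] may be merely monotone: on a bad set the
    decrease is at most the variation of [h], which absolute continuity makes small. The proof is a
    continuous induction along [[a, b]], with a loss [e] per unit of length. *)
Lemma AC_le_of_derive (a b : R) (h N : R -> R) : a <= b ->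
  abs_continuous a b h ->
  {in `[a, b] &, {homo N : x y / x <= y}} ->
  {ae mu, forall t, t \in `[a, b] -> exists2 l, 0 <= l & is_derive t 1 (N \- h) l} ->
  h b - h a <= N b - N a.
Proof.
move=> ab ach Nhomo [E' [mE' E'0 subE]].
pose k := N \- h.
suff H e : 0 < e -> - e * (b - a) - e <= k b - k a.
  rewrite leNgt; apply/negP => lt1.
  pose D := h b - h a - (N b - N a).
  have D0 : 0 < D by rewrite subr_gt0.
  have ba1 : 0 < b - a + 1 by rewrite ltr_wpDl // subr_ge0.
  have := H (D / 2 / (b - a + 1)); rewrite !divr_gt0 // => /(_ isT).
  have -> : - (D / 2 / (b - a + 1)) * (b - a) - D / 2 / (b - a + 1) = - (D / 2).
    by field; rewrite gt_eqF.
  by rewrite /k /D /=; lra.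
move=> e0; have [d d0 hd] := ach e e0.
(* [U] is an open neighbourhood of the exceptional null set, of measure below the [d] that absolute
   continuity of [h] attaches to [e]. *)
have [U [oO E'U Od]] := lebesgue_regularity_outer mE' (eq_ind_r (fun x => (x < +oo)%E) (ltry 0) E'0) d0.
have mO : measurable U by exact: open_measurable.
have Osmall : (mu U < d%:E)%E.
  apply: le_lt_trans Od; rewrite -[leRHS]adde0 -E'0.
  apply: le_trans (measureU2 _ _ _) => //; last exact: measurableD.
  apply: le_measure; rewrite ?inE //; first by apply: measurableU => //; exact: measurableD.
  by move=> x Ox; have [?|?] := pselect (E' x); [right|left].
(* The induction predicate. The list [s] holds the bad intervals met up to [t], in order; their
   total length is charged to [U], and outside them [k] loses at most [e] per unit of length. *)
pose P t := exists s : seq (R * R),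
  [/\ all (fun i => [&& a <= i.1, i.1 <= i.2 & i.2 <= t]) s,
      pairwise (fun i j => i.2 <= j.1) s,
      ((\sum_(i <- s) (i.2 - i.1))%:E <= mu (U `&` `[a, t[))%E
    & - e * (t - a) - \sum_(i <- s) `|h i.2 - h i.1| <= k t - k a].
have mOI x y : measurable (U `&` [set` `[x, y[]) by exact: measurableI.
have step_good t' t : t' <= t -> - e * (t - t') <= k t - k t' -> P t' -> P t.
  move=> tt kt [s [s1 s2 s3 s4]]; exists s; split => //.
  - apply: sub_all s1 => i /and3P[-> -> /= h']; exact: le_trans tt.
  - apply: (le_trans s3); apply: le_measure; [by rewrite inE; exact: mOI..|].
    move=> x [Ux] /=; rewrite !in_itv /= => /andP[-> xt]; split => //=.
    exact: lt_le_trans tt.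
  - lra.
have step_bad t' t : a <= t' -> t' <= t -> t <= b -> [set` `[t', t]] `<=` U ->
    P t' -> P t.
  move=> at' tt tb tO [s [s1 s2 s3 s4]]; exists (rcons s (t', t)); split => //.
  - rewrite all_rcons /= at' tt lexx /=.
    apply: sub_all s1 => i /and3P[-> -> /= h']; exact: le_trans tt.
  - rewrite pairwise_rcons s2 andbT; apply: sub_all s1 => i /and3P[_ _ h'] //.
  - rewrite big_rcons /= EFinD.
    have -> : U `&` `[a, t[ = (U `&` `[a, t'[) `|` `[t', t[%classic.
      apply/seteqP; split => x /=; rewrite !in_itv /=.
        move=> [Ox /andP[ax xt]]; have [xt'|xt'] := ltP x t'.
          by left; rewrite ax.
        by right; rewrite xt.
      move=> [[Ox /andP[ax xt']]|/andP[xt' xt]].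
        by rewrite ax (lt_le_trans xt' tt).
      by rewrite xt (le_trans at' xt'); split => //; apply: tO; rewrite /= in_itv /= xt' ltW.
    have -> : mu ((U `&` `[a, t'[) `|` `[t', t[%classic) =
        (mu (U `&` `[a, t'[) + mu `[t', t[%classic)%E.
      apply: measureU; [exact: mOI|exact: measurable_itv|].
      apply/seteqP; split => // x /=; rewrite !in_itv /= => -[[_ /andP[_ h1]] /andP[h2 _]].
      by move: h2; rewrite leNgt h1.
    rewrite lebesgue_measure_itv /= lte_fin.
    case: ltP => [_|tt']; last first.
      have -> : t = t' by apply/eqP; rewrite eq_le tt tt'.
      by rewrite subrr !adde0.
    by apply: leeD.
  - rewrite big_rcons /=.
    have := Nhomo t' t; rewrite !in_itv /= at' tb (le_trans tt tb) (le_trans at' tt).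
    move=> /(_ isT isT tt) Ntt.
    have := ler_norm (h t - h t').
    rewrite /k /= in s4 *.
    have : 0 <= e * (t - t') by rewrite mulr_ge0 ?subr_ge0 // ltW.
    lra.
pose S := [set t | [/\ a <= t, t <= b & P t]].
have Sa : S a.
  split => //; exists [::]; split => //=; first by rewrite big_nil.
  by rewrite big_nil !subrr mulr0 subrr.
have Sub : has_sup S by split; [exists a|exists b => t []].
pose c := sup S.
have ac : a <= c by apply: ub_le_sup => //; case: Sub.
have cb : c <= b by apply: ge_sup => //; [exists a|move=> t []].
(* Near the supremum [c] one step suffices from either side: a bad interval contained in [U] if [c]
   is exceptional, otherwise a difference quotient of at least [- e]. *)
have [r r0 [r1 r2]] : exists2 r, 0 < r & (forall x, a <= x -> x <= c -> c - r < x -> P x -> P c)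
    /\ (forall y, c <= y -> y <= b -> y < c + r -> P c -> P y).
  have [Ec|Ec] := pselect (E' c).
    have /nbhs_ballP [r /= r0 hr] : nbhs c U by apply: open_nbhs_nbhs; split => //; exact: E'U.
    exists r => //; split=> [x ax xc cx|y cy yb yc].
      apply: step_bad => // z /=; rewrite in_itv /= => /andP[xz zc].
      by apply: hr; rewrite /ball /= ltr_norml; apply/andP; split; lra.
    apply: step_bad => // z /=; rewrite in_itv /= => /andP[xz zc].
    by apply: hr; rewrite /ball /= ltr_norml; apply/andP; split; lra.
  have [l l0 [der Dl]] : exists2 l, 0 <= l & is_derive c 1 k l.
    apply: contrapT => nder; apply: Ec; apply: subE => /= hh.
    by apply: nder; apply: hh; rewrite in_itv /= ac cb.
  have : h^-1 *: ((k \o shift c) (h *: 1) - k c) @[h --> 0^'] --> l.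
    by rewrite -Dl; exact: der.
  move=> /cvgrPdist_lt /(_ e e0) [r /= r0 hr].
  have key x : `|x - c| < r -> x != c -> - e <= (x - c)^-1 * (k x - k c).
    move=> xc xnc; have := hr (x - c); rewrite /= sub0r normrN subr_eq0 => /(_ xc xnc).
    rewrite {1}/GRing.scale /= /GRing.scale /= mulr1 subrK ltr_norml => /andP[h1 h2]; lra.
  exists r => //; split=> [x ax xc cx|y cy yb yc].
    apply: step_good => //; have [->|xnc] := eqVneq x c; first by rewrite !subrr mulr0.
    have xlc : x < c by rewrite lt_neqAle xnc.
    have := key x; rewrite ltr_norml xnc => /(_ _ isT).
    move=> /(_ ltac:(apply/andP; split; lra)).
    have -> : (x - c)^-1 * (k x - k c) = (k c - k x) / (c - x) by field; rewrite !subr_eq0 eq_sym xnc.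
    by rewrite ler_pdivlMr // subr_gt0.
  apply: step_good => //; have [->|xnc] := eqVneq y c; first by rewrite !subrr mulr0.
  have xlc : c < y by rewrite lt_neqAle eq_sym xnc.
  have := key y; rewrite ltr_norml xnc => /(_ _ isT).
  move=> /(_ ltac:(apply/andP; split; lra)).
  by rewrite mulrC ler_pdivlMr // subr_gt0.
have [x [ax xb Px] cx] := sup_adherent r0 Sub.
have Pc : P c by apply: (r1 x) => //; apply: ub_le_sup => //; case: Sub.
have Pb : P b.
  (* [y] satisfies [P] and so cannot exceed [c]. This forces the minimum to be [b]. *)
  pose y := Num.min b (c + r / 2).
  have cy : c <= y by rewrite le_min cb /=; lra.
  have yb : y <= b by rewrite /y ge_min lexx.
  have yr : y < c + r by rewrite /y gt_min; apply/orP; right; lra.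
  have Py := r2 y cy yb yr Pc.
  have yc : y <= c by apply: ub_le_sup; [case: Sub|split => //; exact: le_trans cy].
  have : b <= c + r / 2 -> P b by move=> h'; move: Py; rewrite /y min_l.
  have [//|h' _] := leP b (c + r / 2); first by move=> h' /(_ isT).
  by move: yc; rewrite /y (min_r (ltW h')) => yc; exfalso; lra.
have [s [s1 s2 s3 s4]] := Pb.
have sumlt : \sum_(i <- s) `|h i.2 - h i.1| < e.
  have := hd (size s) (fun i => (nth (0, 0) s i).1) (fun i => (nth (0, 0) s i).2).
  rewrite (big_nth (0, 0)) big_mkord; apply.
  - move=> i; have /allP /(_ (nth (0, 0) s i)) := s1.
    by rewrite mem_nth // => /(_ isT) /and3P[].
  - move=> i j ij; have /(pairwiseP (0, 0)) := s2; apply => //; exact: ltn_ord.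
  - rewrite -lte_fin; apply: le_lt_trans Osmall.
    have := s3; rewrite (big_nth (0, 0)) big_mkord => /le_trans; apply.
    apply: le_measure; [by rewrite inE; exact: mOI|by rewrite inE|exact: subIsetl].
by move: s4; lra.
Qed.

(** The bound is the integral over all of [[0, 1]] even if [T < 1]: it serves to control a curve at
    intermediate times by its full length. *)
Lemma AC_le_integral (h n : R -> R) (T : R) : 0 <= T <= 1 ->
  abs_continuous 0 1 h ->
  (forall t, 0 <= n t) ->
  mu.-integrable `[0, 1] (EFin \o n) ->
  {ae mu, forall t, t \in `[0, 1] -> t <= T -> exists2 l, l <= n t & is_derive t 1 h l} ->
  h T - h 0 <= \int[mu]_(t in `[0, 1]) n t.
Proof.
move=> /andP[T0 T1] ach n0 intn der.
pose n' := n \_ `[0, 1].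
have n'0 t : 0 <= n' t by rewrite /n' patchE; case: ifP.
have intn' D : measurable D -> mu.-integrable D (EFin \o n').
  move=> mD; apply: (@integrableS _ _ _ mu setT) => //.
  have -> : EFin \o n' = (EFin \o n) \_ `[0, 1].
    by apply/funext => t; rewrite /n' /= !patchE; case: ifP.
  by apply/integrable_restrict; rewrite ?setTI.
pose N t := \int[mu]_(x in `]-oo, t]) n' x.
have derN : {ae mu, forall t, derivable N t 1 /\ N^`()%classic t = n' t}.
  apply: FTC1Ny => [y|]; first exact: intn'.
  split; [|exact: openT|].
    by have /integrableP[/measurable_EFinP] := intn' setT measurableT.
  move=> K _ cK; have /integrableP[_] := intn' K (compact_measurable cK).
  by [].
have le_int A B : measurable A -> measurable B -> A `<=` B ->
    \int[mu]_(x in A) n' x <= \int[mu]_(x in B) n' x.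
  move=> mA mB AB; rewrite /Rintegral fine_le //.
  - exact/integrable_fin_num/intn'.
  - exact/integrable_fin_num/intn'.
  - apply: ge0_subset_integral => //; last by move=> x _; rewrite lee_fin.
    by have /integrableP[] := intn' B mB.
have N0 : 0 <= N 0 by apply: Rintegral_ge0.
have NT : N T <= \int[mu]_(t in `[0, 1]) n t.
  have -> : \int[mu]_(t in `[0, 1]) n t = \int[mu]_t n' t.
    by rewrite /Rintegral /n' integral_mkcond restrict_EFin.
  exact: le_int.
suff : h T - h 0 <= N T - N 0 by lra.
apply: AC_le_of_derive => //.
- move=> e e0; have [d d0 hd] := ach e e0; exists d => // m s t h1 h2 h3.
  by apply: hd => // i; have [? [? ?]] := h1 i; do !split => //; exact: le_trans T1.
- by move=> x y _ _ xy; apply: le_int => // z /=; rewrite !in_itv /= => /le_trans; apply.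
have aeF := ae_filter_ringOfSetsType mu.
apply: filterS2 der derN => t h1 [dN N't]; rewrite in_itv /= => /andP[t0 tT].
have t01 : t \in `[0, 1] by rewrite in_itv /= t0 (le_trans tT T1).
have [l ln dl] := h1 t01 tT; exists (n t - l); first by rewrite subr_ge0.
apply: is_deriveB; split => //.
by rewrite -derive1E N't /n' patchE mem_setE t01.
Qed.

End absolute_continuity.

(** * Borel sets of products and affine changes of variable *)

Section measurability.
Context (R : realType).
Local Notation mu := (@lebesgue_measure R).

(** The product sigma-algebra is generated by rectangles. Open sets enter it through the countable
    family of rational boxes, which plays the part of [B]. *)
Lemma measurable_countable_cover d (T : measurableType d) (I : countType)
    (B : I -> set T) (U : set T) : (forall i, measurable (B i)) ->
  (forall p, U p -> exists i, B i p /\ B i `<=` U) -> measurable U.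
Proof.
move=> mB hU.
have -> : U = \bigcup_i [set x | B i `<=` U /\ B i x].
  apply/seteqP; split => [p /hU[i [Bp BU]]|p [i _ /= [BU Bp]]]; first by exists i.
  exact: BU.
apply: countable_bigcupT_measurable => [|i]; first exact: countableP.
have [BU|BU] := pselect (B i `<=` U).
  by rewrite [X in measurable X](_ : _ = B i) //; apply/seteqP; split => [x []|x].
by rewrite [X in measurable X](_ : _ = set0) //; apply/seteqP; split => [x []|x].
Qed.

Lemma rational_box (x e : R) : 0 < e -> exists q r : rat,
  [/\ x \in `](ratr q - ratr r), (ratr q + ratr r)[ &
   forall y, y \in `](ratr q - ratr r), (ratr q + ratr r)[ -> `|x - y| < e].
Proof.
move=> e0; have [r] := @rat_in_itvoo _ 0 (e / 2) (divr_gt0 e0 (ltr0Sn _ _)).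
rewrite in_itv /= => /andP[r0 re].
have [|q] := @rat_in_itvoo _ (x - ratr r) (x + ratr r); first lra.
rewrite in_itv /= => /andP[q1 q2]; exists q, r; split.
  by rewrite in_itv /=; apply/andP; split; lra.
by move=> y; rewrite in_itv /= => /andP[y1 y2]; rewrite ltr_norml; apply/andP; split; lra.
Qed.

Lemma measurable_open_plane (U : set (R * R)) : open U -> measurable U.
Proof.
move=> oU; pose I (i : rat * rat) : set R := [set` `](ratr i.1 - ratr i.2), (ratr i.1 + ratr i.2)[].
apply: (@measurable_countable_cover _ _ _ (fun i : (rat * rat) * (rat * rat) => I i.1 `*` I i.2)).
  by move=> i; apply: measurableX; exact: measurable_itv.
move=> p Up; have /nbhs_ballP[e /= e0 he] : nbhs p U by apply: open_nbhs_nbhs.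
have [q1 [r1 [h1 k1]]] := rational_box p.1 e0.
have [q2 [r2 [h2 k2]]] := rational_box p.2 e0.
exists ((q1, r1), (q2, r2)); split; first by split.
by move=> y [y1 y2]; apply: he; split => /=; [exact: k1|exact: k2].
Qed.

Lemma measurable_open_heis (U : set (heis R)) : open U -> measurable U.
Proof.
move=> oU; pose I (i : rat * rat) : set R := [set` `](ratr i.1 - ratr i.2), (ratr i.1 + ratr i.2)[].
apply: (@measurable_countable_cover _ _ _ (fun i : (rat * rat) * (rat * rat) * (rat * rat) =>
   (I i.1.1 `*` I i.1.2) `*` I i.2)).
  by move=> i; apply: measurableX; [apply: measurableX|]; exact: measurable_itv.
move=> p Up; have /nbhs_ballP[e /= e0 he] : nbhs p U by apply: open_nbhs_nbhs.
have [q1 [r1 [h1 k1]]] := rational_box p.1.1 e0.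
have [q2 [r2 [h2 k2]]] := rational_box p.1.2 e0.
have [q3 [r3 [h3 k3]]] := rational_box p.2 e0.
exists ((q1, r1), (q2, r2), (q3, r3)); split; first by split.
by move=> y [[y1 y2] y3]; apply: he; split => /=; [split => /=; [exact: k1|exact: k2]|exact: k3].
Qed.

Lemma continuous_measurable_plane (f : R * R -> R) : continuous f ->
  measurable_fun setT f.
Proof.
move=> cf; apply: (@measurability _ _ _ _ _ _ _ (RGenOpens.measurableE R)).
move=> _ [_ [a [b ->] <-]]; rewrite setTI; apply: measurable_open_plane.
by apply: open_comp => //; exact: interval_open.
Qed.

Lemma continuous_measurable_heis (f : heis R -> R) : continuous f ->
  measurable_fun setT f.
Proof.
move=> cf; apply: (@measurability _ _ _ _ _ _ _ (RGenOpens.measurableE R)).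
move=> _ [_ [a [b ->] <-]]; rewrite setTI; apply: measurable_open_heis.
by apply: open_comp => //; exact: interval_open.
Qed.

Lemma measurable_affine (a b : R) : measurable_fun setT (fun t : R => a * t + b).
Proof.
apply: continuous_measurable_fun => t.
by apply: cvgD; [apply: cvgMr|exact: cvg_cst].
Qed.

(** [|a|] times the image measure agrees with Lebesgue measure on half-open intervals, hence on all
    measurable sets. *)
Lemma lebesgue_affine (a b : R) (A : set (measurableTypeR R)) : a != 0 -> measurable A ->
  mu ((fun t => a * t + b) @^-1` A) = (`|a|^-1%:E * mu A)%E.
Proof.
move=> a0 mA; pose phi := (fun t : measurableTypeR R => a * t + b : measurableTypeR R).
have na : 0 < `|a| by rewrite normr_gt0.
have mo : measurable_fun setT phi := measurable_affine a b.
pose pm : {measure set (measurableTypeR R) -> \bar R} :=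
  measure_function_pushforward__canonical__measure_function_Measure mu mo.
pose m := mscale (NngNum (normr_ge0 a)) pm.
have E : forall X : set R, ocitv X -> mu X = m X.
  move=> _ [[x y] _ <-].
  rewrite /m /mscale /= /pushforward.
  (* For [a < 0] the preimage of a half-open interval is closed at the other end, which leaves its
     measure unchanged. *)
  have [a1|a1|a1] := ltgtP a 0; last by rewrite a1 eqxx in a0.
    have -> : phi @^-1` `]x, y] = [set` `[(y - b) / a, (x - b) / a[].
      apply/seteqP; split => t /=; rewrite !in_itv /= /phi ler_ndivrMr // ltr_ndivlMr // => /andP[h1 h2].
        by apply/andP; split; lra.
      by apply/andP; split; lra.
    rewrite !lebesgue_measure_itv /= !lte_fin.
    rewrite ltr_nM2r ?invr_lt0 // ltrD2r; case: ifP => _; last by rewrite mule0.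
    by rewrite -!EFinB -EFinM ltr0_norm //; congr EFin; field.
  have -> : phi @^-1` `]x, y] = [set` `](x - b) / a, (y - b) / a]].
    apply/seteqP; split => t /=; rewrite !in_itv /= /phi ltr_pdivrMr // ler_pdivlMr // => /andP[h1 h2].
      by apply/andP; split; lra.
    by apply/andP; split; lra.
  rewrite !lebesgue_measure_itv /= !lte_fin.
  rewrite ltr_pM2r ?invr_gt0 // ltrD2r; case: ifP => _; last by rewrite mule0.
  by rewrite -!EFinB -EFinM gtr0_norm //; congr EFin; field.
have -> : mu A = m A by exact: lebesgue_measure_unique.
by rewrite /m /mscale /= muleA -EFinM mulVf ?gt_eqF // mul1e.
Qed.

Lemma negligible_affine (a b : R) (P : R -> Prop) : a != 0 ->
  {ae mu, forall t, P t} -> {ae mu, forall t, P (a * t + b)}.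
Proof.
move=> a0 [N [mN N0 hN]]; exists ((fun t => a * t + b) @^-1` N); split.
- by rewrite -[X in measurable X]setTI; exact: (measurable_affine a b).
- by rewrite lebesgue_affine // N0 mule0.
- by move=> t /= ht; apply: hN.
Qed.

Lemma integral_affine (a b : R) (D : set (measurableTypeR R))
    (f : measurableTypeR R -> \bar R) : a != 0 ->
  measurable D -> measurable_fun D f -> (forall t, (0 <= f t)%E) ->
  (\int[mu]_(t in (fun t => a * t + b)%R @^-1` D) f (a * t + b)%R =
   `|a|^-1%:E * \int[mu]_(t in D) f t)%E.
Proof.
move=> a0 mD mf f0.
pose phi := (fun t : measurableTypeR R => a * t + b : measurableTypeR R).
have mo : measurable_fun setT phi := measurable_affine a b.
have inv0 : 0 <= `|a|^-1 by rewrite invr_ge0.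
have <- := @ge0_integral_pushforward _ _ _ _ _ phi mo mu D f mD mf (fun t _ => f0 t).
have <- := @ge0_integral_mscale _ _ _ mu D mD (NngNum inv0) f mf (fun t _ => f0 t).
by apply: eq_measure_integral => A mA _; exact: lebesgue_affine.
Qed.

End measurability.

(** * Operations on absolutely continuous maps *)

Section absolutely_continuous_maps.
Context (R : realType) (V : normedModType R).
Implicit Types g : R -> V.

Lemma AC_lipschitz_comp (W : normedModType R) g (h : R -> W) (K : R) :
  abs_continuous 0 1 g -> (forall s t, 0 <= s -> s <= t -> t <= 1 ->
    `|h t - h s| <= K * `|g t - g s|) -> abs_continuous 0 1 h.
Proof.
move=> acg hK e e0; pose L := `|K| + 1.
have L0 : 0 < L by rewrite ltr_wpDl.
have [d d0 hd] := acg (e / L) (divr_gt0 e0 L0); exists d => // n s t h1 h2 h3.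
have := hd n s t h1 h2 h3; rewrite ltr_pdivlMr // mulr_suml; apply: le_lt_trans.
apply: ler_sum => i _; have [s0 [st t1]] := h1 i.
apply: (le_trans (hK _ _ s0 st t1)); rewrite mulrC ler_wpM2l //.
by apply: (le_trans (ler_norm K)); rewrite lerDl.
Qed.

Lemma AC_add g1 g2 : abs_continuous 0 1 g1 -> abs_continuous 0 1 g2 ->
  abs_continuous 0 1 (fun t => g1 t + g2 t).
Proof.
move=> ac1 ac2 e e0; have e2 : 0 < e / 2 by rewrite divr_gt0.
have [d1 d10 h1] := ac1 _ e2; have [d2 d20 h2] := ac2 _ e2.
exists (Num.min d1 d2); first by rewrite lt_min d10 d20.
move=> n s t k1 k2; rewrite lt_min => /andP[k3 k4].
apply: (@le_lt_trans _ _ (\sum_i (`|g1 (t i) - g1 (s i)| + `|g2 (t i) - g2 (s i)|))).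
  by apply: ler_sum => i _; rewrite opprD addrACA ler_normD.
by rewrite big_split /=; have := h1 n s t k1 k2 k3; have := h2 n s t k1 k2 k4; lra.
Qed.

Lemma AC_reparam g (phi : R -> R) (K : R) : abs_continuous 0 1 g ->
  (forall t, 0 <= t <= 1 -> 0 <= phi t <= 1) ->
  (forall s t, s <= t -> phi s <= phi t) ->
  (forall s t, s <= t -> phi t - phi s <= K * (t - s)) ->
  abs_continuous 0 1 (g \o phi).
Proof.
move=> acg p01 pm pK e e0; have [d d0 hd] := acg e e0.
have L0 : 0 < `|K| + 1 by rewrite ltr_wpDl.
exists (d / (`|K| + 1)); first by rewrite divr_gt0.
move=> n s t h1 h2 h3; apply: (hd n (phi \o s) (phi \o t)).
- move=> i; have [s0 [st t1]] := h1 i.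
  have /andP[? _] : 0 <= phi (s i) <= 1 by apply: p01; rewrite s0 (le_trans st).
  have /andP[_ ?] : 0 <= phi (t i) <= 1 by apply: p01; rewrite t1 (le_trans s0).
  by do !split => //; exact: pm.
- by move=> i j ij; apply: pm; exact: h2.
- move: h3; rewrite ltr_pdivlMr // mulr_suml; apply: le_lt_trans.
  apply: ler_sum => i _; have [s0 [st t1]] := h1 i.
  apply: (le_trans (pK _ _ st)); rewrite mulrC ler_wpM2l ?subr_ge0 //.
  by apply: (le_trans (ler_norm K)); rewrite lerDl.
Qed.

(** Absolute continuity is tested on intervals in increasing order, so reversing time also reverses
    their numbering. *)
Lemma AC_reverse g : abs_continuous 0 1 g -> abs_continuous 0 1 (fun t => g (1 - t)).
Proof.
move=> acg e e0; have [d d0 hd] := acg e e0; exists d => // n s t h1 h2 h3.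
have := hd n (fun i => 1 - t (rev_ord i)) (fun i => 1 - s (rev_ord i)).
have E (F : 'I_n -> R) : \sum_i F (rev_ord i) = \sum_i F i.
  by rewrite [RHS](reindex_inj rev_ord_inj).
rewrite (E (fun i => `|g (1 - s i) - g (1 - t i)|)).
rewrite (E (fun i => (1 - s i) - (1 - t i))).
have -> : \sum_i `|g (1 - t i) - g (1 - s i)| = \sum_i `|g (1 - s i) - g (1 - t i)|.
  by apply: eq_bigr => i _; rewrite distrC.
apply.
- by move=> i; have [? [? ?]] := h1 (rev_ord i); do !split; lra.
- move=> i j ij; have := h2 (rev_ord j) (rev_ord i).
  by rewrite /= ltn_sub2lE // => /(_ ij); lra.
- by move: h3; apply: le_lt_trans; apply: ler_sum => i _; lra.
Qed.

(** Each step of length [d / 2] changes [g] by less than 1, and finitely many steps cover [[0, 1]].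
    The bound is what products need in [AC_mul]. *)
Lemma AC_bounded g : abs_continuous 0 1 g ->
  exists2 M : R, 0 <= M & forall t, 0 <= t <= 1 -> `|g t| <= M.
Proof.
move=> acg; have [d d0 hd] := acg 1 ltr01.
have near_ s t : 0 <= s -> s <= t -> t <= 1 -> t - s < d -> `|g t - g s| < 1.
  move=> s0 st t1 tsd; have := hd 1%N (fun=> s) (fun=> t).
  by rewrite !big_ord1; apply => // i j; rewrite !ord1.
have step (k : nat) t : 0 <= t -> t <= 1 -> t <= k%:R * (d / 2) -> `|g t| <= `|g 0| + k%:R.
  elim: k t => [|k IH] t t0 t1.
    by rewrite mul0r addr0 => t0'; have -> : t = 0 by apply/eqP; rewrite eq_le t0 t0'.
  rewrite -natr1 mulrDl mul1r => tk.
  pose s := Num.max 0 (t - d / 2).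
  have s0 : 0 <= s by rewrite le_max lexx.
  have st : s <= t by rewrite ge_max t0 /=; lra.
  have sk : s <= k%:R * (d / 2).
    by rewrite ge_max mulr_ge0 //=; lra.
  have ts : t - s < d by rewrite ltrBlDl -ltrBlDr lt_max; apply/orP; right; lra.
  have := IH s s0 (le_trans st t1) sk; have := near_ s t s0 st t1 ts.
  have := ler_normD (g t - g s) (g s); rewrite subrK; lra.
have [k kd] : exists k : nat, 1 <= k%:R * (d / 2).
  exists (Num.truncn (d / 2)^-1).+1.
  rewrite -ler_pdivrMr ?divr_gt0 // mul1r ltW //.
  by rewrite truncnS_gt // invr_ge0 ltW // divr_gt0.
exists (`|g 0| + k%:R); first by rewrite addr_ge0.
by move=> t /andP[t0 t1]; apply: step => //; exact: le_trans kd.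
Qed.

End absolutely_continuous_maps.

Section derive_tools.
Context (R : realType).

Lemma is_derive_fst (V W : normedModType R) (g : R -> V * W) (t : R) dg :
  is_derive t 1 g dg -> is_derive t 1 (fun s => (g s).1) dg.1.
Proof.
move=> [der D].
have cv : h^-1 *: (((fun s => (g s).1) \o shift t) (h *: 1) - (g t).1) @[h --> 0^'] --> dg.1.
  have : h^-1 *: ((g \o shift t) (h *: 1) - g t) @[h --> 0^'] --> dg by rewrite -D.
  by move=> H; exact: (cvg_comp _ _ H cvg_fst).
by split; [apply/cvg_ex; exists dg.1|exact/cvg_lim].
Qed.

Lemma is_derive_snd (V W : normedModType R) (g : R -> V * W) (t : R) dg :
  is_derive t 1 g dg -> is_derive t 1 (fun s => (g s).2) dg.2.
Proof.
move=> [der D].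
have cv : h^-1 *: (((fun s => (g s).2) \o shift t) (h *: 1) - (g t).2) @[h --> 0^'] --> dg.2.
  have : h^-1 *: ((g \o shift t) (h *: 1) - g t) @[h --> 0^'] --> dg by rewrite -D.
  by move=> H; exact: (cvg_comp _ _ H cvg_snd).
by split; [apply/cvg_ex; exists dg.2|exact/cvg_lim].
Qed.

(** The equality is asked only near [t], because a concatenation agrees with one of its pieces only
    on one side of the junction. *)
Lemma is_derive_affine_near (V : normedModType R) (f g : R -> V) (c : V) (a b t : R) D :
  a != 0 -> is_derive (a * t + b) 1 f D ->
  (\forall s \near t, f (a * s + b) + c = g s) -> is_derive t 1 g (a *: D).
Proof.
move=> a0 [der eD] fg; apply: near_eq_is_derive fg _.
have cv0 : h^-1 *: ((f \o shift (a * t + b)) (h *: 1) - f (a * t + b)) @[h --> 0^'] --> D.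
  by rewrite -eD.
have cva : (a * h) @[h --> 0^'] --> (0^' : set_system R).
  move=> P [e /= e0 he]; exists (e / `|a|) => /=; first by rewrite divr_gt0 ?normr_gt0.
  move=> h /=; rewrite sub0r normrN ltr_pdivlMr ?normr_gt0 // => h1 h2.
  by apply: he; rewrite /= ?sub0r ?normrN ?normrM ?mulf_neq0 // mulrC.
have cv : h^-1 *: (((fun s => f (a * s + b) + c) \o shift t) (h *: 1) - (f (a * t + b) + c))
     @[h --> 0^'] --> a *: D.
  have H := cvgZr (k := a) (cvg_comp _ _ cva cv0).
  have {}H := H ltac:(typeclasses eauto).
  apply: cvg_trans H; apply: near_eq_cvg; near=> h.
  have h0 : h != 0 by near: h; exact: nbhs_dnbhs_neq.
  rewrite /= scalerA invfM mulrA divff // mul1r; congr (_ *: _).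
  rewrite opprD addrACA subrr addr0; congr (f _ - _).
  by rewrite /GRing.scale /= !mulr1; ring.
by split; [apply/cvg_ex; exists (a *: D)|exact/cvg_lim].
Unshelve. all: by end_near. Qed.

Lemma AC_cst (V : normedModType R) (c : V) : abs_continuous 0 1 (fun _ : R => c).
Proof.
move=> e e0; exists 1 => // n s t _ _ _.
by rewrite big1 // => i _; rewrite subrr normr0.
Qed.

Lemma AC_fst (V W : normedModType R) (g : R -> V * W) :
  abs_continuous 0 1 g -> abs_continuous 0 1 (fun t => (g t).1).
Proof.
move=> /AC_lipschitz_comp H; apply: (H _ _ 1) => s t _ _ _.
by rewrite mul1r prod_normE le_max lexx.
Qed.

Lemma AC_snd (V W : normedModType R) (g : R -> V * W) :
  abs_continuous 0 1 g -> abs_continuous 0 1 (fun t => (g t).2).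
Proof.
move=> /AC_lipschitz_comp H; apply: (H _ _ 1) => s t _ _ _.
by rewrite mul1r prod_normE le_max lexx orbT.
Qed.

Lemma AC_scale (f : R -> R) (c : R) :
  abs_continuous 0 1 f -> abs_continuous 0 1 (fun t => c * f t).
Proof.
move=> /AC_lipschitz_comp H; apply: (H _ _ `|c|) => s t _ _ _.
by rewrite -mulrBr normrM.
Qed.

Lemma AC_mul (f g : R -> R) : abs_continuous 0 1 f -> abs_continuous 0 1 g ->
  abs_continuous 0 1 (fun t => f t * g t).
Proof.
move=> acf acg; have [M M0 fM] := AC_bounded acf; have [L L0 gL] := AC_bounded acg.
move=> e e0; pose K := M + L + 1; have K0 : 0 < K by rewrite /K; lra.
have [d1 d10 h1] := acf _ (divr_gt0 e0 (mulr_gt0 (ltr0Sn R 1) K0)).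
have [d2 d20 h2] := acg _ (divr_gt0 e0 (mulr_gt0 (ltr0Sn R 1) K0)).
exists (Num.min d1 d2); first by rewrite lt_min d10 d20.
move=> n s t k1 k2; rewrite lt_min => /andP[k3 k4].
have {k3} := h1 n s t k1 k2 k3; have {k4} := h2 n s t k1 k2 k4.
rewrite !ltr_pdivlMr ?mulr_gt0 // => e1 e2.
apply: (@le_lt_trans _ _ (K * \sum_i `|f (t i) - f (s i)| + K * \sum_i `|g (t i) - g (s i)|)).
  rewrite !mulr_sumr -big_split /=; apply: ler_sum => i _.
  have [s0 [st t1]] := k1 i.
  have -> : f (t i) * g (t i) - f (s i) * g (s i) =
    g (t i) * (f (t i) - f (s i)) + f (s i) * (g (t i) - g (s i)) by ring.
  apply: (le_trans (ler_normD _ _)); rewrite !normrM lerD // ler_wpM2r //.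
    by apply: (le_trans (gL _ _)); [rewrite t1 (le_trans s0 st)|rewrite /K; lra].
  by apply: (le_trans (fM _ _)); [rewrite s0 (le_trans st t1)|rewrite /K; lra].
move: e1 e2; lra.
Qed.

Lemma is_derive_quadratic (X Y Z : R -> R) (x y z a b c t : R) :
  is_derive t 1 X x -> is_derive t 1 Y y -> is_derive t 1 Z z ->
  is_derive t 1 (fun s => a * X s + b * Y s + c * (X s * Y s / 2 + Z s))
    (a * x + b * y + c * ((x * Y t + X t * y) / 2 + z)).
Proof.
move=> dX dY dZ.
have -> : (fun s => a * X s + b * Y s + c * (X s * Y s / 2 + Z s)) =
  (a \*: X) + (b \*: Y) + ((c / 2) \*: (X * Y)) + (c \*: Z).
  apply/funext => s.
  by transitivity (a * X s + b * Y s + (c / 2) * (X s * Y s) + c * Z s); first field.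
have D := is_deriveD (is_deriveD (is_deriveD (is_deriveZ a dX) (is_deriveZ b dY))
  (is_deriveZ (c / 2) (is_deriveM dX dY))) (is_deriveZ c dZ).
by apply: (is_derive_eq D); rewrite /GRing.scale /=; ring.
Qed.

Lemma is_derive_linear3 (g : R -> heis R) (c0 c1 c2 c3 t : R) dg :
  is_derive t 1 g dg ->
  is_derive t 1 (fun s => c0 + c1 * (g s).1.1 + c2 * (g s).1.2 + c3 * (g s).2)
    (c1 * dg.1.1 + c2 * dg.1.2 + c3 * dg.2).
Proof.
move=> dG; have d1 := is_derive_fst dG; have d2 := is_derive_snd dG.
have d11 := is_derive_fst d1; have d12 := is_derive_snd d1.
have -> : (fun s => c0 + c1 * (g s).1.1 + c2 * (g s).1.2 + c3 * (g s).2) =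
   cst c0 + (c1 \*: (fun s => (g s).1.1)) + (c2 \*: (fun s => (g s).1.2)) + (c3 \*: (fun s => (g s).2)).
  by apply/funext => s; rewrite !fctE /GRing.scale.
have D := is_deriveD (is_deriveD (is_deriveD (is_derive_cst c0 t 1) (is_deriveZ c1 d11))
  (is_deriveZ c2 d12)) (is_deriveZ c3 d2).
by apply: (is_derive_eq D); rewrite /GRing.scale /=; ring.
Qed.

Lemma AC_linear3 (g : R -> heis R) (c0 c1 c2 c3 : R) : abs_continuous 0 1 g ->
  abs_continuous 0 1 (fun s => c0 + c1 * (g s).1.1 + c2 * (g s).1.2 + c3 * (g s).2).
Proof.
move=> acg; have a1 := AC_fst acg; have a2 := AC_snd acg.
by apply: AC_add; [apply: AC_add; [apply: AC_add|]|];
  [exact: AC_cst|apply/AC_scale/AC_fst|apply/AC_scale/AC_snd|exact: AC_scale].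
Qed.

End derive_tools.

(** * Lengths of admissible curves *)

Section reachability.
Context (R : realType) (nrm : R * R -> R).
Hypothesis nrmN : is_norm nrm.
Local Notation mu := (@lebesgue_measure R).
Implicit Types p q r : heis R.

Definition reach p q (l : R) := exists g u,
  [/\ admissible g u, g 0 = p, g 1 = q & l = sf_length nrm u].

Lemma sqnorm_continuous : continuous (fun v : R * R => v.1 ^+ 2 + v.2 ^+ 2).
Proof.
by move=> v; apply: cvgD; apply: cvgM; rewrite /=; (exact: cvg_fst || exact: cvg_snd).
Qed.

Lemma speed_measurable (F : R * R -> R) (D : set R) (u : R -> R * R) : continuous F ->
  measurable_fun D u -> measurable_fun D (fun t => F (u t)).
Proof.
move=> cF mu_; apply: (@measurable_comp _ _ _ _ _ _ setT F) => //.
exact: continuous_measurable_plane.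
Qed.

Lemma speed_integrable (u : R -> R * R) : measurable_fun (`[0, 1] : set R) u ->
  (\int[mu]_(t in `[0%R, 1%R]) ((u t).1 ^+ 2 + (u t).2 ^+ 2)%:E < +oo)%E ->
  mu.-integrable `[0, 1] (EFin \o (fun t => nrm (u t))).
Proof.
move=> mu_ fin; pose C := nrm (1, 0) + nrm (0, 1).
have C0 : 0 <= C by rewrite addr_ge0 // norm_ge0.
have int1 : mu.-integrable `[0, 1] (EFin \o (fun t => (u t).1 ^+ 2 + (u t).2 ^+ 2)).
  apply/integrableP; split.
    by apply/measurable_EFinP; apply: (speed_measurable sqnorm_continuous mu_).
  apply: le_lt_trans fin; rewrite le_eqVlt; apply/orP; left; apply/eqP.
  apply: eq_integral => t _ /=.
  by rewrite ger0_norm // addr_ge0 // sqr_ge0.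
have int2 : mu.-integrable `[0, 1] (cst C%:E \+ (fun t => C%:E * ((u t).1 ^+ 2 + (u t).2 ^+ 2)%:E))%E.
  apply: integrableD => //; last exact: integrableZl.
  apply/integrableP; split; first exact: measurable_cst.
  have -> : (\int[mu]_(x in `[0%R, 1%R]) `|cst C%:E x| = \int[mu]_(x in `[0%R, 1%R]) cst `|C|%:E x)%E by [].
  by rewrite integral_cst //= lebesgue_measure_itv /= lte01 oppr0 adde0 mule1 ltry.
apply: (le_integrable _ _ _ int2) => //.
  by apply/measurable_EFinP; exact: (speed_measurable (norm_continuous nrmN) mu_).
move=> t _ /=; rewrite lee_fin ger0_norm ?norm_ge0 //.
apply: le_trans (ler_norm _); apply: (le_trans (norm_le_sum nrmN _)).
rewrite -/C -[X in X + _]mulr1 -mulrDr ler_wpM2l //.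
have sq (a : R) : `|a| <= 1 + a ^+ 2.
  have [a0|a0] := ger0P a; have := sqr_ge0 (a - 1); have := sqr_ge0 (a + 1); nra.
rewrite prod_normE ge_max; have := sq (u t).1; have := sq (u t).2.
have := sqr_ge0 (u t).1; have := sqr_ge0 (u t).2; move=> *.
by apply/andP; split; lra.
Qed.

Lemma reach_ge0 p q l : reach p q l -> 0 <= l.
Proof.
move=> [g [u [_ _ _ ->]]]; apply: Rintegral_ge0 => t _; exact: norm_ge0.
Qed.

Context (v w : R * R) (b : R).
Hypothesis vw : wedge v w = 1.
Hypothesis nrm_ge : forall u, `|wedge u w| + b * `|wedge v u| <= nrm u.

(* The coordinates of p^-1 q in the symplectic basis (v, w). *)
Definition cX p q : R := wedge (q.1 - p.1) w.
Definition cY p q : R := wedge v (q.1 - p.1).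
Definition cZ p q : R := q.2 - p.2 - wedge p.1 q.1 / 2.

(** Along a horizontal curve [X Y / 2 + Z] is the integral of [X dY]. The left side thus has
    derivative [a X' + (be + c X) Y'], the pairing of the velocity with the covector
    [(a, be + c X)]. By [nrm_ge] the dual ball contains [[-1, 1] x [-b, b]], so the derivative is at
    most the speed. *)
Lemma reach_lower_bound p q l : 0 <= b -> reach p q l ->
  forall a be c, `|a| <= 1 -> (forall x, `|x| <= l -> `|be + c * x| <= b) ->
  a * cX p q + be * cY p q + c * (cX p q * cY p q / 2 + cZ p q) <= l.
Proof.
move=> b0 [g [u [[acg mu_ fin der] g0 g1 ->]]].
have intn := speed_integrable mu_ fin.
have XE t : cX p (g t) = (p.1.2 * w.1 - p.1.1 * w.2) + w.2 * (g t).1.1 + (- w.1) * (g t).1.2 + 0 * (g t).2.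
  by rewrite /cX /wedge /=; ring.
have YE t : cY p (g t) = (v.2 * p.1.1 - v.1 * p.1.2) + (- v.2) * (g t).1.1 + v.1 * (g t).1.2 + 0 * (g t).2.
  by rewrite /cY /wedge /=; ring.
have ZE t : cZ p (g t) = - p.2 + (p.1.2 / 2) * (g t).1.1 + (- (p.1.1 / 2)) * (g t).1.2 + 1 * (g t).2.
  by rewrite /cZ /wedge /=; ring.
have XF := funext XE; have YF := funext YE; have ZF := funext ZE.
have acX : abs_continuous 0 1 (fun t => cX p (g t)) by rewrite XF; exact: AC_linear3.
have acY : abs_continuous 0 1 (fun t => cY p (g t)) by rewrite YF; exact: AC_linear3.
have acZ : abs_continuous 0 1 (fun t => cZ p (g t)) by rewrite ZF; exact: AC_linear3.
have n0 t : 0 <= nrm (u t) by exact: norm_ge0.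
have acH a be c : abs_continuous 0 1 (fun s => a * cX p (g s) + be * cY p (g s) +
    c * (cX p (g s) * cY p (g s) / 2 + cZ p (g s))).
  apply: AC_add; first by apply: AC_add; exact: AC_scale.
  apply: AC_scale; apply: AC_add => //.
  have := AC_scale 2^-1 (AC_mul acX acY); congr (abs_continuous 0 1).
  by apply/funext => t; rewrite mulrC.
(* The condition concerns only the times before [T]. Instances with [c = 0] hold unconditionally and
   bound [X] first. *)
have main a be c T : 0 <= T <= 1 -> `|a| <= 1 ->
    (forall t, 0 <= t -> t <= T -> `|be + c * cX p (g t)| <= b) ->
    a * cX p (g T) + be * cY p (g T) + c * (cX p (g T) * cY p (g T) / 2 + cZ p (g T))
     <= sf_length nrm u.
  move=> T01 a1 hbe.
  have -> : a * cX p (g T) + be * cY p (g T) + c * (cX p (g T) * cY p (g T) / 2 + cZ p (g T)) =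
     a * cX p (g T) + be * cY p (g T) + c * (cX p (g T) * cY p (g T) / 2 + cZ p (g T)) -
    (a * cX p (g 0) + be * cY p (g 0) + c * (cX p (g 0) * cY p (g 0) / 2 + cZ p (g 0))).
    by rewrite g0 /cX /cY /cZ !subrr /wedge /=; field.
  apply: (AC_le_integral T01 (acH a be c) n0 intn).
  have aeF := ae_filter_ringOfSetsType mu.
  apply: filterS der => t dert t01 tT; have {}dert := dert t01.
  eexists; last first.
    apply: is_derive_quadratic.
    - by rewrite XF; apply: is_derive_linear3; exact: dert.
    - by rewrite YF; apply: is_derive_linear3; exact: dert.
    - by rewrite ZF; apply: is_derive_linear3; exact: dert.
  apply: le_trans (nrm_ge (u t)).
  have t0 : 0 <= t by move: t01; rewrite in_itv /= => /andP[].
  have := hbe t t0 tT; set x := cX p (g t) => hb.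
  apply: (@le_trans _ _ (a * wedge (u t) w + (be + c * x) * wedge v (u t))); last first.
    apply: lerD.
      apply: (le_trans (ler_norm _)); rewrite normrM; exact: ler_piMl.
    apply: (le_trans (ler_norm _)); rewrite normrM; exact: ler_wpM2r.
  rewrite le_eqVlt; apply/orP; left; apply/eqP.
  have vw' : v.1 * w.2 - v.2 * w.1 = 1 by [].
  rewrite /x /cX /cY /wedge /X1 /X2 /= /GRing.scale /=.
  set u1 := (u t).1; set u2 := (u t).2; set gx := (g t).1.1; set gy := (g t).1.2.
  apply/eqP; rewrite -subr_eq0; apply/eqP.
  (* The two expressions agree modulo [wedge v w = 1]; this is the explicit multiple by which they
     differ. *)
  transitivity (c / 2 * (1 - (v.1 * w.2 - v.2 * w.1)) *
    ((gx - p.1.1) * u2 - (gy - p.1.2) * u1)).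
    by rewrite /u1 /u2 /gx /gy; field.
  by rewrite vw'; ring.
(* The covectors [(1, 0)] and [(-1, 0)] show that [|X|] never exceeds the length, which is the range
   where [be + c x] is assumed to be bounded by [b]. *)
have X_le T : 0 <= T <= 1 -> `|cX p (g T)| <= sf_length nrm u.
  move=> T01; rewrite ler_norml; apply/andP; split.
    have := main (-1) 0 0 T T01; rewrite normrN1 lexx => /(_ isT).
    rewrite !mul0r !addr0 => H; suff : -1 * cX p (g T) <= sf_length nrm u by lra.
    by apply: H => t _ _; rewrite mul0r addr0 normr0.
  have := main 1 0 0 T T01; rewrite normr1 lexx => /(_ isT).
  rewrite !mul0r !addr0 mul1r; apply => t _ _; by rewrite mul0r addr0 normr0.
move=> a be c a1 hbe; rewrite -g1; apply: main => // [|t t0 t1].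
  by rewrite ler01 lexx.
by apply: hbe; apply: X_le; rewrite t0.
Qed.

(** The left translate of a horizontal line through 0 is again a straight line, with constant
    velocity [D]: the fields change along it only by terms in [wedge d d = 0]. *)
Lemma reach_segment p (d : R * R) :
  reach p (hmul p (d.1, d.2, 0)) (nrm d).
Proof.
pose D : heis R := (d, (p.1.1 * d.2 - d.1 * p.1.2) / 2).
exists (fun t => p + t *: D), (fun=> d); split.
- split.
  + move=> e e0; pose K := `|D| + 1; have K0 : 0 < K by rewrite ltr_wpDl.
    exists (e / K); first by rewrite divr_gt0.
    move=> n s t h1 h2; rewrite ltr_pdivlMr // mulr_suml; apply: le_lt_trans.
    apply: ler_sum => i _; have [_ [st _]] := h1 i.
    rewrite opprD addrACA subrr add0r -scalerBl normrZ ger0_norm ?subr_ge0 //.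
    by rewrite ler_wpM2l ?subr_ge0 // lerDl.
  + exact: measurable_cst.
  + rewrite integral_cst //= lebesgue_measure_itv /= lte01 oppr0 adde0 mule1.
    by rewrite ltry.
  + apply: aeW => t _ /=.
    have -> : d.1 *: X1 (p + t *: D) + d.2 *: X2 (p + t *: D) = D.
      case: p @D => [[x y] z]; case: d => d1 d2; rewrite /X1 /X2 /=.
      by congr (_, _, _); rewrite /= /GRing.scale /= /GRing.scale /=; field.
    have cv : h^-1 *: (((fun t => p + t *: D) \o shift t) (h *: 1) - (p + t *: D)) @[h --> 0^'] --> D.
      apply: (@cvg_trans _ (cst D @ (0^' : set_system R))); last exact: cvg_cst.
      apply: near_eq_cvg; near=> h.
      have h0 : h != 0 by near: h; exact: nbhs_dnbhs_neq.
      rewrite /= opprD addrACA subrr add0r -scalerBl addrK scalerA.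
      by rewrite [h%:A]mulr1 mulVf // scale1r.
    by split; [apply/cvg_ex; exists D|exact/cvg_lim].
- by rewrite scale0r addr0.
- rewrite scale1r; case: p @D => [[x y] z]; case: d => d1 d2; rewrite /hmul /=.
  by congr (_, _, _); rewrite /= addr0.
- by rewrite /sf_length /Rintegral integral_cst //= lebesgue_measure_itv /= lte01 oppr0 adde0 mule1.
Unshelve. all: by end_near. Qed.

End reachability.

(** * Reversal and concatenation of curves *)

Section curve_operations.
Context (R : realType) (nrm : R * R -> R).
Hypothesis nrmN : is_norm nrm.
Local Notation mu := (@lebesgue_measure R).
Implicit Types (p q r : heis R) (F : R * R -> R).
Local Notation I01 := ([set` `[(0 : R), (1 : R)]] : set R).

Lemma measurable_rescale (u : R -> R * R) (a b c : R) (D : set R) :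
  measurable D -> (forall t, D t -> 0 <= a * t + b <= 1) ->
  measurable_fun I01 u -> measurable_fun D (fun t => c *: u (a * t + b)).
Proof.
move=> mD Dsub mu_.
have m1 : measurable_fun D (fun t => u (a * t + b)).
  apply: (@measurable_comp _ _ _ _ _ _ I01 u _ (fun t : R => a * t + b)) => //.
    by move=> _ [t Dt <-] /=; rewrite in_itv /=; exact: Dsub.
  by apply: measurable_funTS; exact: measurable_affine.
apply: (@measurable_comp _ _ _ _ _ _ setT (fun v : R * R => c *: v)) => //.
by apply: measurable_fun_pair; apply: measurable_funM => //.
Qed.

(** [F] is either the norm or the squared Euclidean length, with its own homogeneity factor [k]. One
    statement serves both the length and the square integrability of the control. *)
Lemma integral_rescale (F : R * R -> R) (u : R -> R * R) (a b c k : R) (D : set R) :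
  a != 0 -> continuous F -> (forall v, 0 <= F v) ->
  (forall v, F (c *: v) = k * F v) -> 0 <= k ->
  measurable_fun I01 u ->
  measurable D -> D `<=` I01 ->
  (\int[mu]_(t in (fun t => a * t + b)%R @^-1` D) (F (c *: u (a * t + b)%R))%:E <=
   (`|a|^-1 * k)%:E * \int[mu]_(t in `[0%R, 1%R]) (F (u t))%:E)%E.
Proof.
move=> a0 cF F0 Fk k0 mu_ mD D01.
have mF : measurable_fun I01 (fun t => (F (u t))%:E).
  by apply/measurable_EFinP; exact: speed_measurable.
have mFc : measurable_fun D (fun t => (F (c *: u t))%:E).
  rewrite (_ : (fun _ => _) = (fun t => (k%:E * (F (u t))%:E)%E)).
    by apply: measurable_funeM; exact: measurable_funS mF.
  by apply/funext => t; rewrite Fk EFinM.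
rewrite (@integral_affine _ a b D (fun t => (F (c *: u t))%:E)) //.
  rewrite EFinM -muleA lee_pmul2l ?lte_fin ?invr_gt0 ?normr_gt0 //.
  under eq_integral do rewrite Fk EFinM.
  rewrite ge0_integralZl //; first last.
  - by move=> t _; rewrite lee_fin.
  - exact: measurable_funS mF.
  apply: lee_wpmul2l; first by rewrite lee_fin.
  by apply: ge0_subset_integral => // t _; rewrite lee_fin.
by move=> t; rewrite lee_fin.
Qed.

Lemma ae_neq (c : R) : {ae mu, forall t, t != c}.
Proof.
exists [set c]; split => //; first exact: lebesgue_measure_set1.
by move=> t /= /negP; rewrite negbK => /eqP.
Qed.

Lemma reach_reverse p q l : reach nrm p q l -> exists2 l', reach nrm q p l' & l' <= l.
Proof.
move=> [g [u [[acg mu_ fin der] g0 g1 ->]]].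
pose g' t := g (1 - t); pose u' t := -1 *: u (-1 * t + 1).
have sub t : I01 t -> 0 <= -1 * t + 1 <= 1.
  by rewrite /= in_itv /= => /andP[? ?]; apply/andP; split; lra.
have pre : (fun t : R => -1 * t + 1) @^-1` I01 = I01.
  by apply/seteqP; split => t /=; rewrite !in_itv /= => /andP[? ?]; apply/andP; split; lra.
have mu' : measurable_fun I01 u' by exact: measurable_rescale.
have n10 : (-1 : R) != 0 by rewrite oppr_eq0 oner_eq0.
have int (F : R * R -> R) : continuous F -> (forall v, 0 <= F v) -> (forall v, F (-1 *: v) = 1 * F v) ->
   (\int[mu]_(t in `[0%R, 1%R]) (F (u' t))%:E <= \int[mu]_(t in `[0%R, 1%R]) (F (u t))%:E)%E.
  move=> cF F0 Fk; have := integral_rescale 1 n10 cF F0 Fk ler01 mu_ (measurable_itv _) (@subset_refl _ _).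
  by rewrite pre normrN1 invr1 mulr1 mul1e.
have fin' : (\int[mu]_(t in `[0%R, 1%R]) ((u' t).1 ^+ 2 + (u' t).2 ^+ 2)%:E < +oo)%E.
  apply: le_lt_trans fin; apply: (int (fun v => v.1 ^+ 2 + v.2 ^+ 2)) => //.
  - exact: sqnorm_continuous.
  - by move=> v; rewrite addr_ge0 ?sqr_ge0.
  - by move=> v; rewrite /= /GRing.scale /=; ring.
exists (sf_length nrm u'); last first.
  rewrite /sf_length /Rintegral fine_le //.
  - exact/integrable_fin_num/(speed_integrable nrmN mu' fin').
  - exact/integrable_fin_num/(speed_integrable nrmN mu_ fin).
  - apply: int; [exact: norm_continuous|exact: norm_ge0|].
    by move=> v; rewrite scaleN1r normN // mul1r.
exists g', u'; split; [|by rewrite /g' subr0|by rewrite /g' subrr|by []].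
split; [exact: AC_reverse|exact: mu'|exact: fin'|].
have := negligible_affine 1 n10 der.
have aeF := ae_filter_ringOfSetsType mu.
apply: filterS => t dt t01; have := dt (sub t t01) => {}dt.
have := is_derive_affine_near (g := g') (c := 0) n10 dt.
have -> : -1 *: ((u (-1 * t + 1)).1 *: X1 (g (-1 * t + 1)) + (u (-1 * t + 1)).2 *: X2 (g (-1 * t + 1)))
  = (u' t).1 *: X1 (g' t) + (u' t).2 *: X2 (g' t).
  by rewrite scalerDr !scalerA /u' /g' (_ : 1 - t = -1 * t + 1) //; ring.
move=> H; apply: H; exists 1 => //= s _; rewrite addr0 /g'; congr g; ring.
Qed.

Lemma reach_cat p q r l1 l2 : reach nrm p q l1 -> reach nrm q r l2 ->
  exists2 l, reach nrm p r l & l <= l1 + l2.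
Proof.
move=> [g1 [u1 [[ac1 mu1 fin1 der1] g10 g11 ->]]].
move=> [g2 [u2 [[ac2 mu2 fin2 der2] g20 g21 ->]]].
pose f1 (t : R) := Num.min (2 * t) 1; pose f2 (t : R) := Num.max (2 * t - 1) 0.
(* On each half one of the summands is constant: the second vanishes on the first half, the first
   equals [q] on the second half. Absolute continuity then follows from that of a sum, and no
   interval has to be split at [1 / 2]. *)
pose g t := g1 (f1 t) + (g2 (f2 t) - q).
pose u t := if t < 1 / 2 then 2 *: u1 (2 * t + 0) else 2 *: u2 (2 * t + -1).
have two0 : (2 : R) != 0 by rewrite pnatr_eq0.
have E01 : I01 = [set` `[(0 : R), 1 / 2[] `|` [set` `[1 / 2, 1]].
  apply/seteqP; split => t /=; rewrite !in_itv /=.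
    move=> /andP[t0 t1]; have [h|h] := ltP t (1 / 2); first by left; rewrite t0.
    by right; rewrite t1.
  by move=> [|] /andP[? ?]; apply/andP; split; lra.
have pre1 : (fun t : R => 2 * t + 0) @^-1` [set` `[0, 1[] = [set` `[(0 : R), 1 / 2[].
  by apply/seteqP; split => t /=; rewrite !in_itv /= => /andP[? ?]; apply/andP; split; lra.
have pre2 : (fun t : R => 2 * t + -1) @^-1` I01 = [set` `[1 / 2, (1 : R)]].
  by apply/seteqP; split => t /=; rewrite !in_itv /= => /andP[? ?]; apply/andP; split; lra.
have u1E : {in [set` `[(0 : R), 1 / 2[], (fun t => 2 *: u1 (2 * t + 0)) =1 u}.
  by move=> t; rewrite inE /= in_itv /= /u => /andP[_ ->].
have u2E : {in [set` `[1 / 2, (1 : R)]], (fun t => 2 *: u2 (2 * t + -1)) =1 u}.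
  by move=> t; rewrite inE /= in_itv /= /u ltNge => /andP[-> _].
have m1 : measurable_fun [set` `[(0 : R), 1 / 2[] u.
  apply: eq_measurable_fun u1E _; apply: measurable_rescale => // t /=.
  by rewrite in_itv /= => /andP[? ?]; apply/andP; split; lra.
have m2 : measurable_fun [set` `[1 / 2, (1 : R)]] u.
  apply: eq_measurable_fun u2E _; apply: measurable_rescale => // t /=.
  by rewrite in_itv /= => /andP[? ?]; apply/andP; split; lra.
have mu_ : measurable_fun I01 u.
  by rewrite E01; apply/measurable_funU.
have int (F : R * R -> R) (k : R) : continuous F -> (forall v, 0 <= F v) -> (forall v, F (2 *: v) = k * F v) -> 0 <= k ->
   (\int[mu]_(t in `[0%R, 1%R]) (F (u t))%:E <= (2^-1 * k)%:E * \int[mu]_(t in `[0%R, 1%R]) (F (u1 t))%:E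
     + (2^-1 * k)%:E * \int[mu]_(t in `[0%R, 1%R]) (F (u2 t))%:E)%E.
  move=> cF F0 Fk k0.
  have I1 := integral_rescale 0 two0 cF F0 Fk k0 mu1 (measurable_itv `[0, 1[).
  have {I1} := I1 _; rewrite pre1 (gtr0_norm (ltr0Sn R 1)) => I1.
  have I2 := integral_rescale (-1) two0 cF F0 Fk k0 mu2 (measurable_itv `[0, 1]) (@subset_refl _ _).
  move: I2; rewrite pre2 (gtr0_norm (ltr0Sn R 1)) => I2.
  rewrite E01 ge0_integral_setU //; first last.
  - rewrite disj_set2E; apply/eqP/seteqP; split => t //=; rewrite !in_itv /= => -[/andP[_ h1] /andP[h2 _]].
    by move: h1; rewrite ltNge h2.
  - by move=> t _; rewrite lee_fin.
  - by rewrite -E01; apply/measurable_EFinP; exact: speed_measurable.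
  rewrite -E01; apply: leeD.
    apply: le_trans (I1 _).
      rewrite le_eqVlt; apply/orP; left; apply/eqP.
      by apply: eq_integral => t h; rewrite -u1E.
    by move=> t /=; rewrite !in_itv /= => /andP[-> /ltW].
  apply: le_trans I2.
  rewrite le_eqVlt; apply/orP; left; apply/eqP.
  by apply: eq_integral => t h; rewrite -u2E.
have fin : (\int[mu]_(t in `[0%R, 1%R]) ((u t).1 ^+ 2 + (u t).2 ^+ 2)%:E < +oo)%E.
  have := int (fun v => v.1 ^+ 2 + v.2 ^+ 2) 4.
  move=> /(_ (@sqnorm_continuous R)) H; apply: le_lt_trans (H _ _ _) _ => //.
  - by move=> v; rewrite addr_ge0 ?sqr_ge0.
  - by move=> v; rewrite /= /GRing.scale /=; ring.
  - by apply: lte_add_pinfty; apply: lte_mul_pinfty => //; rewrite lee_fin mulr_ge0.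
exists (sf_length nrm u); last first.
  have i1 : (\int[mu]_(t in `[0%R, 1%R]) (nrm (u1 t))%:E)%E \is a fin_num.
    exact/integrable_fin_num/(speed_integrable nrmN mu1 fin1).
  have i2 : (\int[mu]_(t in `[0%R, 1%R]) (nrm (u2 t))%:E)%E \is a fin_num.
    exact/integrable_fin_num/(speed_integrable nrmN mu2 fin2).
  rewrite /sf_length /Rintegral -fineD // fine_le //.
  - exact/integrable_fin_num/(speed_integrable nrmN mu_ fin).
  - by rewrite fin_numD i1 i2.
  - have := int nrm 2 (norm_continuous nrmN) (norm_ge0 nrmN).
    rewrite mulVf // !mul1e; apply => // v0.
    by case: nrmN => _ -> _; rewrite gtr0_norm.
exists g, u; split => //; last first.
- by rewrite /g /f1 /f2 mulr1 min_r ?ler1n // max_l ?subr_ge0 ?ler1n // g11 addrCA subrr addr0 (_ : 2 - 1 = 1) //; ring.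
- by rewrite /g /f1 /f2 mulr0 min_l // max_r ?sub0r ?lerN10 // g10 g20 subrr addr0.
split => //.
- apply: AC_add.
    apply: (AC_reparam (K := 2) ac1).
    + by move=> t /andP[t0 t1]; rewrite /f1 minElt; clear -t0 t1 nrmN; case: ltP => ?; apply/andP; split; lra.
    + by move=> s t st; rewrite /f1 !minElt; clear -st nrmN; case: ltP => ?; case: ltP => ?; lra.
    + by move=> s t st; rewrite /f1 !minElt; clear -st nrmN; case: ltP => ?; case: ltP => ?; lra.
  apply: AC_add; last exact: AC_cst.
  apply: (AC_reparam (K := 2) ac2).
  + by move=> t /andP[t0 t1]; rewrite /f2 maxElt; clear -t0 t1 nrmN; case: ltP => ?; apply/andP; split; lra.
  + by move=> s t st; rewrite /f2 !maxElt; clear -st nrmN; case: ltP => ?; case: ltP => ?; lra.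
  + by move=> s t st; rewrite /f2 !maxElt; clear -st nrmN; case: ltP => ?; case: ltP => ?; lra.
have D1 := negligible_affine 0 two0 der1; have D2 := negligible_affine (-1) two0 der2.
have aeF := ae_filter_ringOfSetsType mu.
(* At the junction time the derivative may fail to exist; one point is negligible. *)
apply: filterS3 D1 D2 (ae_neq (1 / 2)) => t D1 D2 tn; rewrite in_itv /= => /andP[t0 t1].
have [t2|t2|t2] := ltgtP t (1 / 2); last by rewrite t2 eqxx in tn.
- have gE s : s < 1 / 2 -> g1 (2 * s + 0) + 0 = g s.
    move=> s2; rewrite /g /f1 /f2 min_l ?max_r ?g20 ?subrr ?addr0 //; by clear -s2 nrmN; lra.
  have {}D1 : is_derive (2 * t + 0) 1 g1 ((u1 (2 * t + 0)).1 *: X1 (g1 (2 * t + 0)) + (u1 (2 * t + 0)).2 *: X2 (g1 (2 * t + 0))).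
    by apply: D1; rewrite in_itv /=; clear -t0 t2 nrmN; apply/andP; split; lra.
  have := is_derive_affine_near (g := g) (c := 0) two0 D1.
  rewrite scalerDr !scalerA -[g1 (2 * t + 0)]addr0 gE // /u t2; apply.
  near=> s; apply: gE; near: s; exact: lt_nbhsl.
- have gE s : 1 / 2 < s -> g2 (2 * s + -1) + 0 = g s.
    move=> s2; rewrite /g /f1 /f2 min_r ?max_l ?g11 ?addr0 1?addrCA ?subrr ?addr0 //; by clear -s2 nrmN; lra.
  have {}D2 : is_derive (2 * t + -1) 1 g2 ((u2 (2 * t + -1)).1 *: X1 (g2 (2 * t + -1)) + (u2 (2 * t + -1)).2 *: X2 (g2 (2 * t + -1))).
    by apply: D2; rewrite in_itv /=; clear -t1 t2 nrmN; apply/andP; split; lra.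
  have := is_derive_affine_near (g := g) (c := 0) two0 D2.
  rewrite scalerDr !scalerA -[g2 (2 * t + -1)]addr0 gE // /u ltNge (ltW t2) /=; apply.
  near=> s; apply: gE; near: s; exact: lt_nbhsr.
Unshelve. all: by end_near. Qed.

End curve_operations.

(** * The distance *)

Section metric.
Context (R : realType) (nrm : R * R -> R).
Hypothesis nrmN : is_norm nrm.
Implicit Types p q r : heis R.
Local Notation d := (d_SF nrm).

(** A rectangle with signed sides [s] and [s'], run around once, encloses the signed area
    [s s' = z]. *)
Lemma reach_vertical p (z : R) : exists2 l, reach nrm p (p.1, p.2 + z) l &
  l <= 2 * (nrm (1, 0) + nrm (0, 1)) * Num.sqrt `|z|.
Proof.
pose s := Num.sqrt `|z|; pose s' := Num.sg z * s.
have s0 : 0 <= s by exact: sqrtr_ge0.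
have ss : s * s' = z.
  by rewrite /s' mulrCA -expr2 sqr_sqrtr // mulr_sg_norm.
have s's : `|s'| <= s.
  rewrite normrM normr_sg (ger0_norm s0).
  by case: (z != 0); rewrite ?mul1r ?mul0r.
have sg (p' : heis R) (d' : R * R) := reach_segment nrm p' d'.
have nZ := (let: And3 _ h _ := nrmN in h).
have e1 c : nrm (c, 0) = `|c| * nrm (1, 0).
  by rewrite -nZ; congr nrm; congr (_, _); rewrite /= /GRing.scale /= ?mulr1 ?mulr0.
have e2 c : nrm (0, c) = `|c| * nrm (0, 1).
  by rewrite -nZ; congr nrm; congr (_, _); rewrite /= /GRing.scale /= ?mulr1 ?mulr0.
have [l1 r1 h1] := reach_cat nrmN (sg p (s, 0)) (sg _ (0, s')).
have [l2 r2 h2] := reach_cat nrmN r1 (sg _ (- s, 0)).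
have [l3 r3 h3] := reach_cat nrmN r2 (sg _ (0, - s')).
exists l3.
  move: r3; congr (reach _ _ _ _).
  case: p {r1 r2} => [[x y] z'] /=; congr (_, _, _); rewrite ?addr0 /=; try ring.
  by rewrite -ss; field.
rewrite (e1 s) (e2 s') (ger0_norm s0) in h1.
rewrite (e1 (- s)) normrN (ger0_norm s0) in h2; rewrite (e2 (- s')) normrN in h3.
have := ler_wpM2r (norm_ge0 nrmN (0, 1)) s's.
rewrite -/s; lra.
Qed.

(** A horizontal segment reaches the right projection and a vertical move corrects the height. This
    shows that distances are infima of nonempty sets and, in [d_SF_near], that they vary
    continuously. *)
Lemma reach_bound p q : exists2 l, reach nrm p q l &
  l <= nrm (q.1 - p.1) + 2 * (nrm (1, 0) + nrm (0, 1)) * Num.sqrt `|cZ p q|.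
Proof.
have r1 := reach_segment nrm p (q.1 - p.1).
have [l2 r2 h2] := reach_vertical (hmul p ((q.1 - p.1).1, (q.1 - p.1).2, 0)) (cZ p q).
have [l r h] := reach_cat nrmN r1 r2.
exists l; last by lra.
move: r; congr (reach _ _ _ _).
case: p {h h2 r1 r2} => [[x y] z]; case: q => [[x' y'] z'].
by rewrite /cZ /wedge /=; congr (_, _, _); rewrite /=; [ring|ring|field].
Qed.

Let has_inf_reach p q : has_inf [set l | reach nrm p q l].
Proof.
split; first by have [l r _] := reach_bound p q; exists l.
by exists 0 => l /(reach_ge0 nrmN).
Qed.

Lemma d_SF_le p q l : reach nrm p q l -> d p q <= l.
Proof. by move=> r; apply: ge_inf => //; case: (has_inf_reach p q). Qed.

Lemma d_SF_ge0 p q : 0 <= d p q.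
Proof.
apply: lb_le_inf; first by case: (has_inf_reach p q).
by move=> l /(reach_ge0 nrmN).
Qed.

Lemma d_SF_approx p q e : 0 < e -> exists2 l, reach nrm p q l & l < d p q + e.
Proof. by move=> e0; have [l r h] := inf_adherent e0 (has_inf_reach p q); exists l. Qed.

Lemma d_SF_triangle p q r : d p r <= d p q + d q r.
Proof.
apply/ler_addgt0Pr => e e0; have e2 : 0 < e / 2 by rewrite divr_gt0.
have [l1 r1 h1] := d_SF_approx p q e2; have [l2 r2 h2] := d_SF_approx q r e2.
have [l rl hl] := reach_cat nrmN r1 r2; have := d_SF_le rl; lra.
Qed.

Lemma d_SF_sym p q : d p q = d q p.
Proof.
suff H p' q' : d p' q' <= d q' p' by apply/eqP; rewrite eq_le !H.
apply/ler_addgt0Pr => e e0; have [l1 r1 h1] := d_SF_approx q' p' e0.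
have [l rl hl] := reach_reverse nrmN r1; have := d_SF_le rl; lra.
Qed.

Lemma d_SF_near p e : 0 < e -> \forall q \near p, d p q < e.
Proof.
move=> e0; pose h (q : heis R) := nrm (q.1 - p.1) +
  2 * (nrm (1, 0) + nrm (0, 1)) * Num.sqrt `|cZ p q|.
suff : h q @[q --> p] --> 0.
  move=> /cvgrPdist_lt /(_ e e0); apply: filterS => q.
  rewrite sub0r normrN => hq; have [l r hl] := reach_bound p q.
  apply: (le_lt_trans (d_SF_le r)); apply: (le_lt_trans hl).
  exact: le_lt_trans (ler_norm _) hq.
have c1 : (q.1 : R * R) @[q --> p] --> p.1 by exact: cvg_fst.
have c2 : (q.2 : R) @[q --> p] --> p.2 by exact: cvg_snd.
have c11 : (q.1.1 : R) @[q --> p] --> p.1.1 by exact: (cvg_comp _ _ c1 cvg_fst).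
have c12 : (q.1.2 : R) @[q --> p] --> p.1.2 by exact: (cvg_comp _ _ c1 cvg_snd).
have -> : 0 = nrm (p.1 - p.1) + 2 * (nrm (1, 0) + nrm (0, 1)) * Num.sqrt `|cZ p p|.
  rewrite subrr (norm0 nrmN) /cZ subrr wedgevv mul0r subrr normr0 sqrtr0 mulr0 addr0 //.
apply: cvgD.
  apply: (cvg_comp (fun q : heis R => q.1 - p.1) nrm); last exact: norm_continuous.
  by apply: cvgB => //; exact: cvg_cst.
apply: cvgMr; apply: (cvg_comp _ Num.sqrt); last exact: sqrt_continuous.
apply: cvg_norm; rewrite /cZ; apply: cvgB.
  by apply: cvgB => //; exact: cvg_cst.
by apply: cvgMl; rewrite /wedge; apply: cvgB; apply: cvgMr.
Qed.

Lemma d_SF_ball_open p (r : R) : open [set q | d p q < r].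
Proof.
rewrite openE => q /= dr; rewrite /interior.
have e0 : 0 < r - d p q by rewrite subr_gt0.
apply: filterS (d_SF_near q e0) => q' /= h.
have := d_SF_triangle p q q'; lra.
Qed.

Context (v w : R * R) (b : R).
Hypothesis b0 : 0 < b.
Hypothesis vw : wedge v w = 1.
Hypothesis nrm_ge : forall u, `|wedge u w| + b * `|wedge v u| <= nrm u.

(** [L] strictly exceeds the distance, so that the condition on the covector covers all curves that
    nearly realise the infimum. *)
Lemma d_SF_lower p q a be c L : d p q < L -> `|a| <= 1 ->
  (forall x, `|x| <= L -> `|be + c * x| <= b) ->
  a * cX w p q + be * cY v p q + c * (cX w p q * cY v p q / 2 + cZ p q) <= d p q.
Proof.
move=> dL a1 hb; apply/ler_addgt0Pr => e e0.
have e' : 0 < Num.min e (L - d p q) by rewrite lt_min e0 subr_gt0.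
have [l r] := d_SF_approx p q e'; rewrite -ltrBlDl lt_min => /andP[h1 h2].
apply: le_trans (_ : l <= _); last by lra.
apply: (reach_lower_bound nrmN vw nrm_ge (ltW b0) r a1) => x xl.
by apply: hb; lra.
Qed.

(** The case [c = 0], with constant covectors at the four corners of the rectangle. *)
Lemma d_SF_ge_norm p q : `|cX w p q| + b * `|cY v p q| <= d p q.
Proof.
have dL : d p q < d p q + 1 by rewrite ltrDl.
have H a be : `|a| <= 1 -> `|be| <= b -> a * cX w p q + be * cY v p q <= d p q.
  move=> a1 be1; have := @d_SF_lower p q a be 0 _ dL a1; rewrite mul0r addr0; apply.
  by move=> x _; rewrite mul0r addr0.
have N1 : `|-1 : R| <= 1 by rewrite normrN1.
have P1 : `|1 : R| <= 1 by rewrite normr1.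
have Pb : `|b| <= b by rewrite gtr0_norm.
have Nb : `|- b| <= b by rewrite normrN gtr0_norm.
have := H _ _ P1 Pb; have := H _ _ P1 Nb; have := H _ _ N1 Pb; have := H _ _ N1 Nb.
by have [x0|x0] := ger0P (cX w p q); have [y0|y0] := ger0P (cY v p q); lra.
Qed.

(* For curves of length at most l, the covector field (1, b (1 - l + x)) stays in
   the dual ball, which contains [-1, 1] x [-b, b]. *)
Lemma d_SF_calibration p q : d p q < 1 ->
  cX w p q + b * (1 - d p q) * cY v p q + b * (cX w p q * cY v p q / 2 + cZ p q) <= d p q.
Proof.
move=> d1; set X := cX w p q; set Y := cY v p q; set Z := cZ p q.
apply/ler_addgt0Pr => e e0; have bY : 0 < b * `|Y| + 1.
  by rewrite ltr_wpDl // mulr_ge0 // ltW.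
(* The slack for curves slightly longer than the distance: [d p q + f <= 1] keeps the covector in
   the rectangle, and the second bound absorbs the change [b f Y] of the calibrating function. *)
pose f := Num.min (1 - d p q) (e / (b * `|Y| + 1)).
have f0 : 0 < f by rewrite lt_min subr_gt0 d1 divr_gt0.
have fe : f * (b * `|Y| + 1) <= e by rewrite -ler_pdivlMr // /f ge_min lexx orbT.
have f1 : f <= 1 - d p q by rewrite /f ge_min lexx.
have dL : d p q < d p q + f by rewrite ltrDl.
have := @d_SF_lower p q 1 (b * (1 - (d p q + f))) b _ dL.
rewrite normr1 lexx => /(_ isT) H.
have : forall x, `|x| <= d p q + f -> `|b * (1 - (d p q + f)) + b * x| <= b.
  move=> x; rewrite -mulrDr normrM (gtr0_norm b0) ger_pMr // !ler_norml => /andP[x1 x2].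
  by apply/andP; split; lra.
move=> /H; rewrite -/X -/Y -/Z mul1r.
have : b * f * Y <= f * (b * `|Y|).
  by rewrite [b * f]mulrC -mulrA ler_pM2l // ler_pM2l // ler_norm.
lra.
Qed.

(** Small balls of [d_SF] are small for the Euclidean topology, the converse of [d_SF_near].
    Evaluations of curves thereby become continuous for uniform convergence in [d_SF]. *)
Lemma d_SF_separates p (U : set (heis R)) : nbhs p U ->
  exists2 e, 0 < e & forall q, d p q < e -> U q.
Proof.
move=> /nbhs_ballP[e /= e0 he].
pose K := `|v| + `|w| / b + 2 / b + `|wedge p.1 v| + `|wedge p.1 w| / b + 1.
have ib : 0 < b^-1 by rewrite invr_gt0.
have K0 : 0 < K.
  rewrite /K ltr_wpDl // !addr_ge0 // ?mulr_ge0 // ltW //.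
have eK : 0 < e / K by rewrite divr_gt0.
exists (Num.min 1 (e / K)); first by rewrite lt_min ltr01 eK.
move=> q; set D := d p q; rewrite lt_min => /andP[D1 De]; apply: he.
have D0 : 0 <= D by exact: d_SF_ge0.
have := d_SF_ge_norm p q; rewrite -/D; set X := cX w p q; set Y := cY v p q => XY.
have bY0 : 0 <= b * `|Y| by rewrite mulr_ge0 // ltW.
have XD : `|X| <= D by have := normr_ge0 X; lra.
have YD : `|Y| <= D / b by rewrite ler_pdivlMr // mulrC; have := normr_ge0 X; lra.
(* The covector [(0, b s x)] stays in the rectangle for [|x| <= 1]. This is why only distances below
   1 are considered. *)
have CD : `|X * Y / 2 + cZ p q| <= D / b.
  have H (s : R) : `|s| <= 1 -> b * s * (X * Y / 2 + cZ p q) <= D.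
    move=> s1; have := @d_SF_lower p q 0 0 (b * s) 1 D1; rewrite normr0 ler01 => /(_ isT).
    rewrite !mul0r !add0r; apply => x x1; rewrite add0r !normrM (gtr0_norm b0).
    rewrite -mulrA ger_pMr // mulr_ile1 //.
  have := H 1; have := H (-1); rewrite normrN normr1 lexx => /(_ isT) h1 /(_ isT) h2.
  by rewrite ler_norml -mulNr ler_pdivrMr // ler_pdivlMr //; apply/andP; split; lra.
have q1 : q.1 - p.1 = X *: v + Y *: w := wedge_decomp (q.1 - p.1) vw.
have q2 : q.2 - p.2 = cZ p q + (X * wedge p.1 v + Y * wedge p.1 w) / 2.
  have -> : X * wedge p.1 v + Y * wedge p.1 w = wedge p.1 (q.1 - p.1).
    by rewrite q1 wedgeDr !wedgeZr.
  by rewrite /cZ /wedge /=; field.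
have DK : D * K < e by rewrite -ltr_pdivlMr.
have YX : `|X * Y| <= D / b.
  rewrite normrM; apply: (@le_trans _ _ (1 * (D / b))); last by rewrite mul1r.
  by apply: ler_pM => //; lra.
have XV (x : R) : 0 <= x -> `|X| * x <= D * x by move=> x0; exact: ler_wpM2r.
have YV (x : R) : 0 <= x -> `|Y| * x <= D / b * x by move=> x0; exact: ler_wpM2r.
have n1 : `|q.1 - p.1| <= D * K.
  rewrite q1; apply: (le_trans (ler_normD _ _)); rewrite !normrZ.
  have := XV _ (normr_ge0 v); have := YV _ (normr_ge0 w).
  have : 0 <= D * (2 / b + `|wedge p.1 v| + `|wedge p.1 w| / b + 1).
    by rewrite mulr_ge0 // !addr_ge0 // ?mulr_ge0 // ltW.
  rewrite /K; lra.
have n2 : `|q.2 - p.2| <= D * K.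
  have -> : q.2 - p.2 = (X * Y / 2 + cZ p q) + (- (X * Y) / 2 + (X * wedge p.1 v + Y * wedge p.1 w) / 2).
    by rewrite q2; ring.
  apply: (le_trans (ler_normD _ _)).
  have : `|- (X * Y) / 2 + (X * wedge p.1 v + Y * wedge p.1 w) / 2| <=
     (`|X * Y| + (`|X| * `|wedge p.1 v| + `|Y| * `|wedge p.1 w|)) / 2.
    rewrite -mulrDl normrM [`|2^-1|]gtr0_norm ?invr_gt0 // ler_pM2r ?invr_gt0 //.
    apply: (le_trans (ler_normD _ _)); rewrite normrN lerD2l.
    by apply: (le_trans (ler_normD _ _)); rewrite !normrM.
  have := XV _ (normr_ge0 (wedge p.1 v)); have := YV _ (normr_ge0 (wedge p.1 w)).
  have : 0 <= D * (`|v| + `|w| / b + 1).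
    by rewrite mulr_ge0 // !addr_ge0 // ?mulr_ge0 // ltW.
  have : 0 <= D * `|wedge p.1 v| by exact: mulr_ge0.
  have : 0 <= D / b * `|wedge p.1 w| by rewrite !mulr_ge0 // ltW.
  have : 0 <= D / b by rewrite mulr_ge0 // ltW.
  rewrite /K; lra.
rewrite -ball_normE /= distrC prod_normE /= gt_max.
by rewrite (le_lt_trans n1) // (le_lt_trans n2).
Qed.

End metric.

(** * Midpoints *)

Section midpoints.
Context (R : realType).

(* A = X Y / 2 - Z is the area below the projected curve; X', Y', A' are the
   coordinates of the second half, E the excess of the length over x + b y. *)
Lemma midpoint_algebra (b X Y A x y a h E M Q : R) : 0 < b -> 0 < y -> 0 <= E ->
  h <= 1 -> `|X| + b * `|Y| <= h -> `|x - X| + b * `|y - Y| <= h ->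
  2 * h <= x + b * y + E ->
  X + b * (1 - h) * Y + b * (X * Y - A) <= h ->
  (x - X) + b * (1 - h) * (y - Y) + b * ((x - X) * (y - Y) - (a - A - Y * (x - X))) <= h ->
  y + E / b <= M -> (b * M + E) * M <= Q -> b * y + E <= 1 / 2 -> 1 <= x ->
  [/\ `|X - x / 2| <= (b * y + E) / 2,
      `|Y| <= E / b + 4 * (`|a| + 2 * (E / b) + 2 * Q)
    & `|A| <= `|a| + 2 * (E / b) + Q].
Proof.
move=> b0 y0 E0 h1 F1 F2 F3 F4 F5 yM MQ bE x1.
have EbE : b * (E / b) = E by rewrite mulrC divfK ?gt_eqF.
have Eb0 : 0 <= E / b by rewrite divr_ge0 // ltW.
have X_ : X <= `|X| := ler_norm X; have X'_ : x - X <= `|x - X| := ler_norm _.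
have Y_ : Y <= `|Y| := ler_norm Y; have Y'_ : y - Y <= `|y - Y| := ler_norm _.
have NY_ : - Y <= `|Y| by rewrite -normrN ler_norm.
have NY'_ : - (y - Y) <= `|y - Y| by rewrite -[`|y - Y|]normrN ler_norm.
have bY_ : b * Y <= b * `|Y| by rewrite ler_pM2l.
have bNY_ : - (b * Y) <= b * `|Y| by rewrite -mulrN ler_pM2l.
have bY'_ : b * (y - Y) <= b * `|y - Y| by rewrite ler_pM2l.
have bNY'_ : - (b * (y - Y)) <= b * `|y - Y| by rewrite -mulrN ler_pM2l.
have by0 : 0 < b * y by exact: mulr_gt0.
have nX0 : 0 <= `|X| := normr_ge0 X; have nX'0 : 0 <= `|x - X| := normr_ge0 _.
have nY0 : 0 <= b * `|Y| by rewrite mulr_ge0 // ltW.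
have nY'0 : 0 <= b * `|y - Y| by rewrite mulr_ge0 // ltW.
have bM : b * y + E <= b * M by rewrite -[X in _ + X]EbE -mulrDr ler_pM2l.
have bYM : b * `|Y| <= b * M by clear -bM F1 F2 F3 X_ X'_ bY'_ bY_ nY0 nY'0 bNY_ bNY'_; lra.
have bYM' : b * `|y - Y| <= b * M by clear -bM F1 F2 F3 X_ X'_ bY'_ bY_ nY0 nY'0 bNY_ bNY'_; lra.
have YM : `|Y| <= M by rewrite -(ler_pM2l b0).
have Y'M : `|y - Y| <= M by rewrite -(ler_pM2l b0).
have M0 : 0 <= M := le_trans (normr_ge0 _) YM.
have hX : 0 <= h - X by clear -F1 X_ nY0; lra.
have hX' : 0 <= h - (x - X) by clear -F2 X'_ nY'0; lra.
(* Here [h - X] is at most [b y + E] and [|Y|] is at most [M], so this correction in the calibration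
   is of second order. *)
have q1 : b * ((h - X) * Y) <= b * Q.
  rewrite ler_pM2l //; apply: le_trans MQ; apply: (le_trans (ler_norm _)).
  rewrite normrM; apply: ler_pM => //; rewrite ger0_norm //.
  by clear -F1 F2 F3 X_ X'_ bM nY0 nY'0 bNY_ bNY'_ bY_ bY'_; lra.
have q2 : b * ((h - (x - X)) * (y - Y)) <= b * Q.
  rewrite ler_pM2l //; apply: le_trans MQ; apply: (le_trans (ler_norm _)).
  rewrite normrM; apply: ler_pM => //; rewrite ger0_norm //.
  by clear -F1 F2 F3 X_ X'_ bM nY0 nY'0 bNY_ bNY'_ bY_ bY'_; lra.
have Q0 : 0 <= Q.
  by apply: le_trans MQ; rewrite mulr_ge0 // addr_ge0 // mulr_ge0 // ltW.
(* The excesses of the two halves add up to at most [E], so each is at most [E]. The first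
   calibration then bounds the area below the first half from below. *)
have A1 : - (E / b + Q) <= A.
  rewrite -(ler_pM2l b0) mulrN mulrDr EbE.
  by clear -F1 F2 F3 F4 F5 q1 q2 X_ X'_ bY_ bNY_ bY'_ bNY'_ nY0 nY'0; lra.
(* The same for the second half, whose own area is [a - A - Y (x - X)]. Together with [A1] this
   bounds the rectangle [Y (x - X)]. *)
have A2 : A + Y * (x - X) <= a + E / b + Q.
  rewrite -(ler_pM2l b0) !mulrDr EbE.
  by clear -F1 F2 F3 F4 F5 q1 q2 X_ X'_ bY_ bNY_ bY'_ bNY'_ nY0 nY'0; lra.
(* The width of the rectangle: [X <= h <= (x + 1 / 2) / 2]. It turns the bound on its area into one
   on the height [Y]. *)
have Xq : 1 / 4 <= x - X by clear -F1 F2 F3 x1 bE X_ X'_ E0 by0 nY0 nY'0 h1; lra.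
have X1 : x - X <= 1 by clear -F2 h1 X'_ nY'0; lra.
(* If [Y < 0], the two halves have total height variation at least [y - 2 Y]; the surplus is paid by
   the excess [E]. *)
have Ylow : - (E / b) <= Y * 2.
  by rewrite -(ler_pM2l b0) mulrN EbE; clear -F1 F2 F3 X_ X'_ bY_ bNY_ bY'_ bNY'_; lra.
have a_ : a <= `|a| := ler_norm a; have a0 : 0 <= `|a| := normr_ge0 a.
have YX : - (E / b) <= Y * (x - X).
  have [Y0|Y0] := ler0P Y.
    have : Y * 1 <= Y * (x - X) by rewrite ler_wnM2l.
    by clear -Ylow Eb0; lra.
  have : 0 <= Y * (x - X) by rewrite mulr_ge0 ?ltW // (lt_le_trans _ Xq).
  by clear -Eb0; lra.
split.
- rewrite ler_norml; apply/andP.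
  by clear -F1 F2 F3 X_ X'_ bY_ bNY_ bY'_ bNY'_ nY0 nY'0 E0 by0; split; lra.
- have [Y0|Y0] := ler0P Y; first by clear -Ylow Eb0 a0 Q0; lra.
  have : Y * (1 / 4) <= Y * (x - X) by rewrite ler_pM2l.
  by clear -A1 A2 a_ Eb0 a0 Q0; lra.
- by rewrite ler_norml; apply/andP; clear -A1 A2 YX a_ a0 Eb0 Q0; split; lra.
Qed.

Context (nrm : R * R -> R).
Hypothesis nrmN : is_norm nrm.
Context (v w : R * R) (b : R).
Hypothesis b0 : 0 < b.
Hypothesis vw : wedge v w = 1.
Hypothesis nv : nrm v = 1.
Hypothesis nrm_ge : forall u, `|wedge u w| + b * `|wedge v u| <= nrm u.
Local Notation d := (d_SF nrm).

Definition area (q : heis R) : R := wedge q.1 w * wedge v q.1 / 2 - q.2.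

(** The curve runs along [v] over [x - dl], then straight to the end. The triangle below its second
    side has area [dl y / 2], which fixes [dl = 2 a / y]. The slope [y / dl] of that side is at most
    [s], so convexity carries the estimate from [v + s w] to it. *)
Lemma d_SF_polygon (q : heis R) (s k : R) : 0 < s ->
  nrm (v + s *: w) <= 1 + b * s + k * s ->
  0 < wedge v q.1 -> 0 < area q -> (wedge v q.1) ^+ 2 <= 2 * area q * s ->
  2 * area q / wedge v q.1 <= wedge q.1 w ->
  d 0 q <= wedge q.1 w + b * wedge v q.1 + k * wedge v q.1.
Proof.
move=> s0 hs; set x := wedge q.1 w; set y := wedge v q.1; set a := area q.
move=> y0 a0 ys; set dl := 2 * a / y => dx.
have dl0 : 0 < dl by rewrite divr_gt0 // mulr_gt0.
pose sg := y / dl; have sg0 : 0 < sg by rewrite divr_gt0.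
have sgs : sg <= s.
  by rewrite ler_pdivrMr // /dl mulrA ler_pdivlMr // mulrC -expr2 [s * _]mulrC.
have nsg : nrm (v + sg *: w) <= 1 + b * sg + k * sg.
  have := norm_convex nrmN v (v + s *: w) (divr_ge0 (ltW sg0) (ltW s0)).
  rewrite ler_pdivrMr // mul1r => /(_ sgs).
  have -> : (1 - sg / s) *: v + (sg / s) *: (v + s *: w) = v + sg *: w.
    by rewrite scalerDr scalerA divfK ?gt_eqF // addrA -scalerDl subrK scale1r.
  move=> /le_trans; apply; rewrite nv mulr1.
  have : sg / s * nrm (v + s *: w) <= sg / s * (1 + b * s + k * s).
    by rewrite ler_pM2l // divr_gt0.
  have -> : sg / s * (1 + b * s + k * s) = sg / s + b * sg + k * sg.
    by field; rewrite gt_eqF.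
  lra.
have nZ := (let: And3 _ h _ := nrmN in h).
have r1 := reach_segment nrm (0 : heis R) ((x - dl) *: v).
have r2 := reach_segment nrm (hmul 0 (((x - dl) *: v).1, ((x - dl) *: v).2, 0)) (dl *: v + y *: w).
have [l rl hl] := reach_cat nrmN r1 r2.
have qE : q.1 = x *: v + y *: w := wedge_decomp q.1 vw.
have rq : reach nrm 0 q l.
  have qq : q = (x * v.1 + y * w.1, x * v.2 + y * w.2, x * y / 2 - a).
    rewrite [LHS]surjective_pairing {1}qE; congr (_, _).
    by rewrite /a /area -/x -/y; ring.
  have dly : dl * y = 2 * a by rewrite divfK ?gt_eqF.
  have vw' : v.1 * w.2 - v.2 * w.1 = 1 by [].
  move: rl; congr (reach _ _ _ _); rewrite {}qq /hmul /=.
  congr (_, _, _); rewrite /= /GRing.scale /=; [ring|ring|].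
  transitivity ((x * y - dl * y) * (v.1 * w.2 - v.2 * w.1) / 2); first by field.
  by rewrite vw' dly; field.
apply: (le_trans (d_SF_le nrmN rq)); apply: (le_trans hl).
rewrite nZ nv mulr1 ger0_norm ?subr_ge0 //.
have -> : dl *: v + y *: w = dl *: (v + sg *: w).
  by rewrite scalerDr scalerA /sg [dl * _]mulrC divfK ?gt_eqF.
rewrite nZ gtr0_norm //.
have : dl * nrm (v + sg *: w) <= dl * (1 + b * sg + k * sg) by rewrite ler_pM2l.
have -> : dl * (1 + b * sg + k * sg) = dl + b * y + k * y.
  by rewrite /sg; field; rewrite gt_eqF.
lra.
Qed.

(** The second half is translated to the origin, where its coordinates are those of
    [midpoint_algebra]. The upper bounds on [x] and on [b y + E] keep both halves shorter than 1, as
    the calibration demands. *)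
Lemma midpoint_estimate (q m : heis R) (E M Q : R) :
  let x := wedge q.1 w in let y := wedge v q.1 in
  0 < y -> 0 <= E -> 1 <= x -> x <= 5 / 4 ->
  d 0 q <= x + b * y + E -> d 0 m = d 0 q / 2 -> d m q = d 0 q / 2 ->
  y + E / b <= M -> (b * M + E) * M <= Q -> b * y + E <= 1 / 2 ->
  [/\ `|wedge m.1 w - x / 2| <= (b * y + E) / 2,
      `|wedge v m.1| <= E / b + 4 * (`|area q| + 2 * (E / b) + 2 * Q)
    & `|area m| <= `|area q| + 2 * (E / b) + Q].
Proof.
move=> x y y0 E0 x1 x54 dq dm1 dm2 hM hQ hE.
pose h := d 0 q / 2; rewrite -/h in dm1 dm2.
have hlt : h < 1 by rewrite /h; lra.
have X1E : cX w 0 m = wedge m.1 w by rewrite /cX subr0.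
have Y1E : cY v 0 m = wedge v m.1 by rewrite /cY subr0.
have Z1E : cX w 0 m * cY v 0 m / 2 + cZ 0 m = wedge m.1 w * wedge v m.1 - area m.
  rewrite X1E Y1E /area /cZ; have -> : wedge (0 : heis R).1 m.1 = 0 by rewrite /wedge /=; ring.
  by rewrite /= ; field.
have X2E : cX w m q = x - wedge m.1 w by rewrite /x /cX /wedge /=; ring.
have Y2E : cY v m q = y - wedge v m.1 by rewrite /y /cY /wedge /=; ring.
have mE : m.1 = wedge m.1 w *: v + wedge v m.1 *: w := wedge_decomp m.1 vw.
have qE : q.1 = x *: v + y *: w := wedge_decomp q.1 vw.
have mq : wedge m.1 q.1 = wedge m.1 w * y - wedge v m.1 * x.
  rewrite {1}mE {1}qE; set X := wedge m.1 w; set Y := wedge v m.1.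
  rewrite !(wedgeDr, wedgeDl, wedgeZr, wedgeZl) !wedgevv vw.
  have -> : wedge w v = -1 by rewrite -vw /wedge; ring.
  ring.
have Z2E : cX w m q * cY v m q / 2 + cZ m q =
  (x - wedge m.1 w) * (y - wedge v m.1) -
  (area q - area m - wedge v m.1 * (x - wedge m.1 w)).
  by rewrite X2E Y2E /cZ mq /area -/x -/y; field.
apply: (@midpoint_algebra b _ _ _ x y (area q) h E M Q) => //.
- exact: ltW.
- by have := d_SF_ge_norm nrmN b0 vw nrm_ge 0 m; rewrite X1E Y1E dm1.
- by have := d_SF_ge_norm nrmN b0 vw nrm_ge m q; rewrite X2E Y2E dm2.
- by rewrite /h; lra.
- have := @d_SF_calibration _ _ nrmN _ _ _ b0 vw nrm_ge 0 m.
  by rewrite dm1 Z1E X1E Y1E; apply.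
- have := @d_SF_calibration _ _ nrmN _ _ _ b0 vw nrm_ge m q.
  by rewrite dm2 Z2E X2E Y2E; apply.
Qed.

End midpoints.

(** * Volumes *)

Section volumes.
Context (R : realType).
Local Notation mu := (@lebesgue_measure R).
Local Notation RR := (measurableTypeR R * measurableTypeR R)%type.
Implicit Types v w : R * R.

Definition coordinate (pi : R * R -> R) := pi = fst \/ pi = snd.

Lemma coordinate_continuous pi : coordinate pi -> continuous pi.
Proof. by move=> [->|->] u; [exact: cvg_fst|exact: cvg_snd]. Qed.

Lemma wedge_continuous v : continuous (wedge v).
Proof.
by move=> u; apply: cvgB; apply: cvgMr; [exact: cvg_snd|exact: cvg_fst].
Qed.

Lemma wedgel_continuous w : continuous (fun u : R * R => wedge u w).
Proof.
by move=> u; apply: cvgB; apply: cvgMl; [exact: cvg_fst|exact: cvg_snd].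
Qed.

Lemma preimage_itvoo_open (T : topologicalType) (f : T -> R) (a b : R) : continuous f ->
  open (f @^-1` [set` `]a, b[]).
Proof. by move=> cf; apply: open_comp => //; exact: interval_open. Qed.

Lemma lebesgue_affine_itv (a b i1 i2 : R) : a != 0 -> i1 <= i2 ->
  mu ((fun t => a * t + b) @^-1` [set` `]i1, i2[]) = (`|a|^-1 * (i2 - i1))%:E.
Proof.
move=> a0 i12; rewrite lebesgue_affine // lebesgue_measure_itv /= lte_fin.
case: ltP => [_|h]; first by rewrite -EFinB -EFinM.
by rewrite mule0; have -> : i2 = i1 by [apply/eqP; rewrite eq_le h]; rewrite subrr mulr0.
Qed.

Lemma integral_patch_cst d (T : measurableType d) (m : {measure set T -> \bar R})
    (D : set T) (c : R) : measurable D ->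
  (\int[m]_x ((cst c%:E) \_ D) x = c%:E * m D)%E.
Proof. by move=> mD; rewrite -integral_mkcond integral_cst. Qed.

(** [pi u / pi v] stands in for [wedge u w], from which it differs by a multiple of [wedge v u]
    ([coordinate_ratio]). It involves a single Cartesian coordinate, so areas can be computed
    section by section. The pair with [wedge v u] has Jacobian determinant 1. *)
Definition strip pi v (i1 i2 j1 j2 : R) : set (R * R) :=
  [set u | [/\ pi u / pi v \in `]i1, i2[ & wedge v u \in `]j1, j2[] ].

Lemma strip_open pi v i1 i2 j1 j2 : coordinate pi -> open (strip pi v i1 i2 j1 j2).
Proof.
move=> cpi; have -> : strip pi v i1 i2 j1 j2 =
    ((fun u => pi u / pi v) @^-1` [set` `]i1, i2[]) `&` (wedge v @^-1` [set` `]j1, j2[]).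
  by apply/seteqP; split => u [].
apply: openI; apply: preimage_itvoo_open; last exact: wedge_continuous.
by move=> u; apply: cvgMl; exact: coordinate_continuous.
Qed.

Lemma strip_area pi v i1 i2 j1 j2 : coordinate pi -> pi v != 0 -> i1 <= i2 -> j1 <= j2 ->
  (mu \x mu)%E (strip pi v i1 i2 j1 j2) = ((i2 - i1) * (j2 - j1))%:E.
Proof.
move=> cpi pv0 i12 j12; have mS : measurable (strip pi v i1 i2 j1 j2).
  by apply: measurable_open_plane; exact: strip_open.
have pv0' : (pi v)^-1 != 0 by rewrite invr_eq0.
pose I := ((fun t => (pi v)^-1 * t + 0) @^-1` [set` `]i1, i2[]) : set R.
have mI : measurable I.
  by rewrite -[I]setTI; apply: (measurable_affine _ _) => //; exact: measurable_itv.
have muI : mu I = (`|pi v| * (i2 - i1))%:E.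
  by rewrite /I lebesgue_affine_itv // normfV invrK.
have final : (\int[mu]_x ((cst (`|pi v|^-1 * (j2 - j1))%:E) \_ I) x = ((i2 - i1) * (j2 - j1))%:E)%E.
  transitivity ((`|pi v|^-1 * (j2 - j1))%:E * mu I)%E; first exact: integral_patch_cst.
  rewrite muI -EFinM; congr EFin.
  by field; rewrite normr_eq0.
case: cpi => piE; subst pi; rewrite /= in pv0 pv0' I mI muI final *.
  rewrite -final /product_measure1 /=; apply: eq_integral => x _ /=.
  rewrite patchE; case: ifPn => xI.
    rewrite (_ : xsection _ _ = (fun t => v.1 * t + (- (v.2 * x))) @^-1` [set` `]j1, j2[]).
      by rewrite lebesgue_affine_itv.
    apply/seteqP; split => y /=; rewrite /xsection /= inE /strip /wedge /=; first by case.
    by move=> h; split => //; move: xI; rewrite inE /I /= addr0 mulrC.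
  rewrite (_ : xsection _ _ = set0) ?measure0 //.
  apply/seteqP; split => y //=; rewrite /xsection /= inE /strip /= => -[h _].
  by move: xI; rewrite notin_setE; apply; rewrite /I /= addr0 mulrC.
(* When the first condition concerns the second coordinate, the integration is done in the other
   order. *)
have -> : (mu \x mu)%E (strip snd v i1 i2 j1 j2) = (mu \x^ mu)%E (strip snd v i1 i2 j1 j2).
  by apply: product_measure_unique => // A B mA mB; exact: product_measure2E.
rewrite -final /product_measure2 /=; apply: eq_integral => y _ /=.
rewrite patchE; case: ifPn => yI.
  rewrite (_ : ysection _ _ = (fun t => - v.2 * t + v.1 * y) @^-1` [set` `]j1, j2[]).
    by rewrite lebesgue_affine_itv ?oppr_eq0 // normrN.
  apply/seteqP; split => x /=; rewrite /ysection /= inE /strip /wedge /= mulNr addrC; first by case.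
  by move=> h; split => //; move: yI; rewrite inE /I /= addr0 mulrC.
rewrite (_ : ysection _ _ = set0) ?measure0 //.
apply/seteqP; split => x //=; rewrite /ysection /= inE /strip /= => -[h _].
by move: yI; rewrite notin_setE; apply; rewrite /I /= addr0 mulrC.
Qed.

Definition box pi v w (i1 i2 j1 j2 k1 k2 : R) : set (heis R) :=
  [set q | strip pi v i1 i2 j1 j2 q.1 /\ area v w q \in `]k1, k2[ ].

Lemma area_continuous v w : continuous (area v w).
Proof.
move=> q; have c1 : (q'.1 : R * R) @[q' --> q] --> q.1 by exact: cvg_fst.
apply: cvgB; last exact: cvg_snd.
have cx := cvg_comp _ _ c1 (@wedgel_continuous w q.1).
have cy := cvg_comp _ _ c1 (@wedge_continuous v q.1).
by apply: cvgMl; exact: (cvgM cx cy).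
Qed.

Lemma box_open pi v w i1 i2 j1 j2 k1 k2 : coordinate pi -> open (box pi v w i1 i2 j1 j2 k1 k2).
Proof.
move=> cpi; have -> : box pi v w i1 i2 j1 j2 k1 k2 =
    (fst @^-1` (strip pi v i1 i2 j1 j2)) `&` (area v w @^-1` [set` `]k1, k2[]).
  by apply/seteqP; split => u [].
apply: openI; last by apply: preimage_itvoo_open; exact: area_continuous.
apply: open_comp; last exact: strip_open.
by move=> q _; exact: cvg_fst.
Qed.

Lemma box_volume pi v w i1 i2 j1 j2 k1 k2 : coordinate pi -> pi v != 0 ->
  i1 <= i2 -> j1 <= j2 -> k1 <= k2 ->
  lebesgue_heis R (box pi v w i1 i2 j1 j2 k1 k2) = ((i2 - i1) * (j2 - j1) * (k2 - k1))%:E.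
Proof.
move=> cpi pv0 i12 j12 k12; pose S := strip pi v i1 i2 j1 j2.
have mS : measurable S by apply: measurable_open_plane; exact: strip_open.
rewrite /lebesgue_heis /product_measure1 /=.
transitivity (\int[(mu \x mu)%E]_u ((cst (k2 - k1)%:E) \_ S) u)%E.
  apply: eq_integral => u _; rewrite patchE; case: ifPn => uS.
    rewrite /= (_ : xsection _ _ = (fun t => -1 * t + wedge u w * wedge v u / 2) @^-1` [set` `]k1, k2[]).
      by rewrite lebesgue_affine_itv ?oppr_eq0 ?oner_eq0 // normrN1 invr1 mul1r.
    apply/seteqP; split => z /=; rewrite /xsection /= inE /box /area /= mulN1r addrC; first by case.
    by move=> h; split => //; move: uS; rewrite inE.
  rewrite /= (_ : xsection _ _ = set0) ?measure0 //.
  apply/seteqP; split => z //=; rewrite /xsection /= inE /box /= => -[h _].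
  by move: uS; rewrite notin_setE.
transitivity ((k2 - k1)%:E * (mu \x mu) S)%E; first exact: integral_patch_cst.
by rewrite strip_area // -EFinM mulrC.
Qed.

Lemma box_nbhs pi v w (c : R) (U : set (heis R)) : coordinate pi -> pi v != 0 ->
  wedge v w = 1 -> nbhs ((c *: v, 0) : heis R) U ->
  exists2 e, 0 < e & forall q : heis R, `|pi q.1 / pi v - c| < e -> `|wedge v q.1| < e ->
    `|area v w q| < e -> U q.
Proof.
move=> cpi pv0 vw nU.
pose k := pi w / pi v.
(* The inverse of the coordinates [(pi q.1 / pi v, wedge v q.1, area v w q)] that define boxes. Its
   continuity at [(c, 0, 0)] gives the claim. *)
pose Phi (p : heis R) : heis R :=
  ((p.1.1 - k * p.1.2) *: v + p.1.2 *: w, (p.1.1 - k * p.1.2) * p.1.2 / 2 - p.2).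
have piL (x y : R) : pi (x *: v + y *: w) = x * pi v + y * pi w.
  by case: cpi => ->; rewrite /= /GRing.scale /=.
have cPhi : {for ((c, 0, 0) : heis R), continuous Phi}.
  have c1 : (q'.1 : R * R) @[q' --> ((c, 0, 0) : heis R)] --> (c, 0 : R) by exact: cvg_fst.
  have c2 : (q'.2 : R) @[q' --> ((c, 0, 0) : heis R)] --> (0 : R) by exact: cvg_snd.
  have c11 : (q'.1.1 : R) @[q' --> ((c, 0, 0) : heis R)] --> (c : R) by exact: (cvg_comp _ _ c1 cvg_fst).
  have c12 : (q'.1.2 : R) @[q' --> ((c, 0, 0) : heis R)] --> (0 : R) by exact: (cvg_comp _ _ c1 cvg_snd).
  have cx : (q'.1.1 - k * q'.1.2 : R) @[q' --> ((c, 0, 0) : heis R)] --> (c - k * 0 : R).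
    by apply: cvgB => //; apply: cvgMr.
  have H1 : ((q'.1.1 - k * q'.1.2) *: v + q'.1.2 *: w : R * R) @[q' --> ((c, 0, 0) : heis R)]
      --> ((c - k * 0) *: v + 0 *: w : R * R) by apply: cvgD; apply: cvgZl.
  have H2 : ((q'.1.1 - k * q'.1.2) * q'.1.2 / 2 - q'.2 : R) @[q' --> ((c, 0, 0) : heis R)]
      --> ((c - k * 0) * 0 / 2 - 0 : R) by apply: cvgB => //; apply: cvgMl; apply: cvgM.
  exact: (cvg_pair H1 H2).
have Phic : Phi (c, 0, 0) = (c *: v, 0).
  by rewrite /Phi /= !(mulr0, subr0, scale0r, addr0, mul0r).
have : nbhs ((c, 0, 0) : heis R) (Phi @^-1` U) by apply: cPhi; rewrite Phic.
move=> /nbhs_ballP [e /= e0 he]; exists e => // q h1 h2 h3.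
have := he (pi q.1 / pi v, wedge v q.1, area v w q).
have -> : (Phi @^-1` U) (pi q.1 / pi v, wedge v q.1, area v w q) = U q.
  rewrite /= /Phi /=; congr U.
  have qE := wedge_decomp q.1 vw.
  have xE : pi q.1 / pi v - k * wedge v q.1 = wedge q.1 w.
    by rewrite {1}qE piL /k; field.
  rewrite xE -qE /area [RHS]surjective_pairing; congr (_, _); ring.
apply; split => /=; first by split; rewrite /ball /= distrC // subr0.
by rewrite /ball /= distrC subr0.
Qed.

Section smooth_measure.
Context (m : {measure set (heis R) -> \bar R}) (rho : heis R -> R).
Hypothesis rho_cont : continuous rho.
Hypothesis rho_gt0 : forall p, 0 < rho p.
Hypothesis m_rho : forall B, measurable B ->
  m B = (\int[lebesgue_heis R]_(p in B) (rho p)%:E)%E.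

Let mrho (B : set (heis R)) : measurable_fun B (fun p => (rho p)%:E).
Proof.
by apply/measurable_EFinP; apply: measurable_funTS; exact: continuous_measurable_heis.
Qed.

Lemma density_upper (B : set (heis R)) (k : R) : measurable B ->
  (forall p, B p -> rho p <= k) -> (m B <= k%:E * lebesgue_heis R B)%E.
Proof.
move=> mB rk; rewrite m_rho // -integral_cst //.
apply: ge0_le_integral => //.
- by move=> p _; rewrite lee_fin ltW.
- exact: mrho.
Qed.

Lemma density_lower (B : set (heis R)) (k : R) : measurable B -> 0 <= k ->
  (forall p, B p -> k <= rho p) -> (k%:E * lebesgue_heis R B <= m B)%E.
Proof.
move=> mB k0 rk; rewrite m_rho // -integral_cst //.
apply: ge0_le_integral => //.
- exact: mrho.
Qed.

Lemma density_open_gt0 (p : heis R) (U : set (heis R)) : measurable U -> nbhs p U ->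
  (0 < m U)%E.
Proof.
move=> mU nU.
have r2 : 0 < rho p / 2 by rewrite divr_gt0.
have nr : \forall q \near p, rho p / 2 < rho q.
  have /cvgrPdist_lt /(_ _ r2) := @rho_cont p; apply: filterS => q.
  by rewrite ltr_norml => /andP[]; lra.
have /nbhs_ballP[e /= e0 he] : nbhs p (U `&` [set q | rho p / 2 < rho q]) by exact: filterI.
pose I (x : R) := [set` `](x - e), (x + e)[] : set R.
pose B : set (heis R) := (I p.1.1 `*` I p.1.2) `*` I p.2.
have Iin x y : I x y -> ball x e y.
  by rewrite /I /= in_itv /= /ball /= ltr_norml => /andP[? ?]; apply/andP; split; lra.
have BU q : B q -> (U `&` [set q | rho p / 2 < rho q]) q.
  move=> [[h1 h2] h3]; apply: he; split; [split|]; exact: Iin.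
have mI x : measurable (I x) by exact: measurable_itv.
have mB : measurable B by apply: measurableX => //; exact: measurableX.
apply: (@lt_le_trans _ _ (m B)); last first.
  by apply: le_measure; rewrite ?inE // => q /BU[].
have muI x : mu (I x) = (2 * e)%:E.
  rewrite /I lebesgue_measure_itv /= lte_fin ifT; last by lra.
  by rewrite -EFinB; congr EFin; ring.
have volB : lebesgue_heis R B = (2 * e * (2 * e) * (2 * e))%:E.
  transitivity ((mu \x mu) (I p.1.1 `*` I p.1.2) * mu (I p.2))%E.
    by apply: product_measure1E; [apply: measurableX; exact: mI|exact: mI].
  transitivity (mu (I p.1.1) * mu (I p.1.2) * mu (I p.2))%E.
    by congr (_ * _)%E; apply: product_measure1E; exact: mI.
  by rewrite !muI -!EFinM.
apply: lt_le_trans (density_lower mB (ltW r2) _).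
  by rewrite volB -EFinM lte_fin !mulr_gt0.
by move=> q /BU[_ /= /ltW].
Qed.

End smooth_measure.
End volumes.

(** * Distortion and contraction *)

Section distortion.
Context (R : realType).

Lemma sinh_double (x : R) : sinh (x * 2) = sinh x * (expR x + expR (- x)).
Proof.
have -> : x * 2 = x + x by ring.
by rewrite /sinh opprD !expRD; field.
Qed.

(** The double-angle formulas turn the coefficient at [1 / 2] into [1 / (2 cos)] or [1 / (2 cosh)]
    of half the angle. For [K >= 0] the square root in the constant is that of a nonpositive number,
    hence 0, and the constant is [1 / 2]. *)
Lemma sigma_half_lower (K M theta Theta : R) : 0 < M -> 0 <= theta <= Theta ->
  ((2 * expR (Theta * Num.sqrt (- K / M)))^-1%:E <= sigma K M 2^-1 theta)%E.
Proof.
move=> M0 /andP[th0 thT]; set c := _^-1.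
have E1 : 1 <= expR (Theta * Num.sqrt (- K / M)).
  by rewrite -expR0 ler_expR mulr_ge0 ?sqrtr_ge0 // (le_trans th0).
have c2 : c <= 2^-1.
  by rewrite /c lef_pV2 ?posrE ?mulr_gt0 ?expR_gt0 // ler_peMr.
rewrite /sigma; case: ifPn => [_|]; first by rewrite leey.
rewrite -ltNge => hlt; case: ifPn => [_|]; first by rewrite lee_fin.
move=> Kth; have th : 0 < theta.
  rewrite lt_neqAle th0 andbT eq_sym; apply: contra Kth => /eqP ->.
  by rewrite expr0n mulr0.
case: ifPn => [Kp|Kn].
  have K0 : 0 < K by move: Kp; rewrite pmulr_lgt0 // exprn_gt0.
  have al0 : 0 < theta * Num.sqrt (K / M).
    by rewrite mulr_gt0 // sqrtr_gt0 divr_gt0.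
  have -> : 2^-1 * theta * Num.sqrt (K / M) = theta * Num.sqrt (K / M) / 2 by ring.
  have : (theta * Num.sqrt (K / M)) ^+ 2 < pi ^+ 2.
    rewrite exprMn sqr_sqrtr ?divr_ge0 ?ltW // mulrA ltr_pdivrMr // mulrC [X in _ < X]mulrC //.
  move=> sq; have alpi : theta * Num.sqrt (K / M) < pi.
    by rewrite -ltr_sqr // nnegrE; [exact: ltW|exact: pi_ge0].
  set al := theta * _ in al0 alpi *.
  have s0 : 0 < sin (al / 2) by apply: sin_gt0_pi; apply/andP; split; lra.
  have sa0 : 0 < sin al by apply: sin_gt0_pi; rewrite al0.
  rewrite lee_fin; apply: (le_trans c2); rewrite ler_pdivlMr //.
  have ale : al = (al / 2) *+ 2 by rewrite -mulr_natr divfK.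
  have -> : 2^-1 * sin al = cos (al / 2) * sin (al / 2).
    by rewrite {1}ale sin_mulr2n; field.
  by rewrite ger_pMl // cos_le1.
have K0 : K < 0.
  rewrite ltNge; apply: contra Kn => Kge; rewrite lt_neqAle eq_sym Kth /=.
  by rewrite mulr_ge0 // sqr_ge0.
have -> : 2^-1 * theta * Num.sqrt (- K / M) = theta * Num.sqrt (- K / M) / 2 by ring.
have al0 : 0 < theta * Num.sqrt (- K / M).
  by rewrite mulr_gt0 // sqrtr_gt0 divr_gt0 // oppr_gt0.
have alT : theta * Num.sqrt (- K / M) <= Theta * Num.sqrt (- K / M).
  by rewrite ler_wpM2r // sqrtr_ge0.
set al := theta * _ in al0 alT *.
have sh : 0 < sinh (al / 2).
  by rewrite /sinh divr_gt0 // subr_gt0 ltr_expR; lra.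
have -> : sinh al = sinh (al / 2) * (expR (al / 2) + expR (- (al / 2))).
  by rewrite -sinh_double divfK.
have p0 : 0 < expR (al / 2) + expR (- (al / 2)) by rewrite addr_gt0 // expR_gt0.
rewrite invfM mulrA divff ?gt_eqF // mul1r lee_fin /c lef_pV2 ?posrE ?mulr_gt0 ?expR_gt0 //.
have h1 : expR (al / 2) <= expR (Theta * Num.sqrt (- K / M)) by rewrite ler_expR; lra.
have h2 : expR (- (al / 2)) <= 1 by rewrite -[leRHS]expR0 ler_expR; lra.
lra.
Qed.

Lemma tau_half_lower (K N Theta : R) : 1 < N -> exists2 c, 0 < c &
  forall theta, 0 <= theta <= Theta -> (c%:E <= poweR (tau K N 2^-1 theta) N)%E.
Proof.
move=> N1; have N0 : 0 < N by exact: lt_trans N1.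
have M0 : 0 < N - 1 by rewrite subr_gt0.
pose s := (2 * expR (Theta * Num.sqrt (- K / (N - 1))))^-1.
have s0 : 0 < s by rewrite invr_gt0 mulr_gt0 // expR_gt0.
have e0 : 0 <= 1 - N^-1 by rewrite subr_ge0 invf_le1 // ltW.
pose t := (2^-1 : R) `^ N^-1 * s `^ (1 - N^-1).
have t0 : 0 < t by rewrite mulr_gt0 // powR_gt0 // invr_gt0.
exists (t `^ N); first exact: powR_gt0.
move=> theta hth; rewrite -poweR_EFin; apply: gt0_ler_poweR; first exact: ltW.
- by rewrite in_itv /= lee_fin ltW // leey.
- by rewrite in_itv /= leey andbT /tau mule_ge0 // ?lee_fin ?powR_ge0 // poweR_ge0.
rewrite /tau /t EFinM; apply: lee_wpmul2l; first by rewrite lee_fin powR_ge0.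
rewrite -poweR_EFin; apply: gt0_ler_poweR => //.
- by rewrite in_itv /= lee_fin ltW // leey.
- rewrite in_itv /= leey andbT; apply: le_trans (sigma_half_lower K M0 hth).
  by rewrite lee_fin ltW.
- exact: sigma_half_lower.
Qed.

End distortion.

(** * From the contraction property to volumes of sets of midpoints *)

Section contraction.
Context (R : realType).

(* [ge0_le_integral] does not apply to the integrand of MCP, whose measurability
   is not known. *)
Lemma ge0_integral_mono d (T : measurableType d) (m : {measure set T -> \bar R})
    (D : set T) (f1 f2 : T -> \bar R) :
  (forall x, D x -> (0 <= f1 x)%E) -> (forall x, D x -> (f1 x <= f2 x)%E) ->
  (\int[m]_(x in D) f1 x <= \int[m]_(x in D) f2 x)%E.
Proof.
move=> f10 f12; rewrite !ge0_integralE //; last first.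
  by move=> x Dx; exact: le_trans (f10 x Dx) (f12 x Dx).
apply: le_ereal_sup => _ [h /= hf <-]; exists h => //= x.
apply: (le_trans (hf x)); rewrite !patchE; case: ifPn => //.
by rewrite inE => /f12.
Qed.

Lemma probability_setI1 d (T : measurableType d) (P : probability T R) (A B : set T) :
  measurable A -> measurable B -> P A = 1%E -> P B = 1%E -> P (A `&` B) = 1%E.
Proof.
move=> mA mB PA PB.
have mAB : measurable (A `\` B) by exact: measurableD.
have : P (A `\` B) = 0%E.
  apply/eqP; rewrite -measure_le0; apply: (@le_trans _ _ (P (~` B))).
    by apply: le_measure; [rewrite inE|rewrite inE; exact: measurableC|move=> x []].
  by rewrite probability_setC // PB subee.
move=> H; rewrite -PA -[in RHS](setUIDK A B) measureU //; last first.
- by rewrite setDE setIACA setICr setI0.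
- exact: measurableI.
by transitivity (P (A `&` B) + 0)%E; [rewrite adde0|congr (_ + _)%E; exact/esym].
Qed.

Context (nrm : R * R -> R).
Hypothesis nrmN : is_norm nrm.
Context (v w : R * R) (b : R).
Hypothesis b0 : 0 < b.
Hypothesis vw : wedge v w = 1.
Hypothesis nrm_ge : forall u, `|wedge u w| + b * `|wedge v u| <= nrm u.
Local Notation d := (d_SF nrm).
Local Notation curvesH := (curves d).

Lemma measurable_unif_open (U : set curvesH) : unif_open d U -> measurable U.
Proof. exact: sub_sigma_algebra. Qed.

Lemma measurable_ev_open (t : {i01 R}) (U : set (heis R)) : open U ->
  measurable (ev (dist := d) t @^-1` U).
Proof.
move=> oU; apply: measurable_unif_open => g Ug.
have [e e0 he] := d_SF_separates nrmN b0 vw nrm_ge (open_nbhs_nbhs (conj oU Ug)).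
by exists e => // h hh; apply: he; exact: hh.
Qed.

Lemma closed_point (p : heis R) : closed [set p].
Proof.
by apply: accessible_closed_set1; apply: hausdorff_accessible; exact: norm_hausdorff.
Qed.

Lemma measurable_ev_point (t : {i01 R}) (p : heis R) :
  measurable (ev (dist := d) t @^-1` [set p]).
Proof.
rewrite -[X in measurable X]setCK; apply: measurableC.
rewrite preimage_setC; apply: measurable_ev_open.
by apply: closed_openC; exact: closed_point.
Qed.

Lemma d_SF_perturb p q p' q' : d p q <= d p' q' + d p' p + d q' q.
Proof.
have := d_SF_triangle nrmN p p' q; have := d_SF_triangle nrmN p' q' q.
rewrite (d_SF_sym nrmN p p'); lra.
Qed.

Lemma measurable_Geo : measurable (Geo d : set curvesH).
Proof.
rewrite -[X in measurable X]setCK; apply: measurableC.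
apply: measurable_unif_open => g /= /existsNP[s /existsNP[t /eqP nst]].
set z := 0%:i01 in nst; set o := 1%:i01 in nst.
pose D := `|d (g s) (g t) - `|t%:num - s%:num| * d (g z) (g o)|.
have D0 : 0 < D by rewrite normr_gt0 subr_eq0.
(* Moving all values of [g] by less than [D / 5] changes each of the two distances by at most
   [2 D / 5], hence the defect by at most [4 D / 5], which cannot cancel it. *)
exists (D / 5) => [|h gh]; first by rewrite divr_gt0.
move=> /(_ s t); rewrite -/z -/o; set k := `|_ - _| => E.
have k1 : k <= 1.
  have s0 : 0 <= s%:num by []. have s1 : s%:num <= 1 by [].
  have t0 : 0 <= t%:num by []. have t1 : t%:num <= 1 by [].
  by rewrite /k ler_norml; apply/andP; split; lra.
have k0 : 0 <= k by exact: normr_ge0.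
have a1 := d_SF_perturb (g s) (g t) (h s) (h t).
have a2 := d_SF_perturb (h s) (h t) (g s) (g t).
have a3 := d_SF_perturb (g z) (g o) (h z) (h o).
have a4 := d_SF_perturb (h z) (h o) (g z) (g o).
rewrite (d_SF_sym nrmN (h s) (g s)) (d_SF_sym nrmN (h t) (g t)) in a1.
rewrite (d_SF_sym nrmN (h z) (g z)) (d_SF_sym nrmN (h o) (g o)) in a3.
have hs := gh s; have ht := gh t; have hz := gh z; have ho := gh o.
have : `|d (g s) (g t) - k * d (g z) (g o)| <= 4 / 5 * D.
  have -> : d (g s) (g t) - k * d (g z) (g o) =
    (d (g s) (g t) - d (h s) (h t)) - k * (d (g z) (g o) - d (h z) (h o)).
    by rewrite E; ring.
  apply: (le_trans (ler_normB _ _)); rewrite normrM (ger0_norm k0).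
  have n1 : `|d (g s) (g t) - d (h s) (h t)| <= 2 / 5 * D.
    by rewrite ler_norml; apply/andP; split; lra.
  have n2 : `|d (g z) (g o) - d (h z) (h o)| <= 2 / 5 * D.
    by rewrite ler_norml; apply/andP; split; lra.
  have : k * `|d (g z) (g o) - d (h z) (h o)| <= 1 * (2 / 5 * D).
    by apply: ler_pM.
  lra.
by rewrite -/D; lra.
Qed.

Lemma midpoint_i01 : exists h : {i01 R}, h%:num = 2^-1.
Proof.
have h : Itv.spec (Itv.num_sem (R := R)) (Itv.Real `[0%Z, 1%Z]) 2^-1.
  rewrite /= /Itv.num_sem num_real /= in_itv /=.
  by rewrite invr_ge0 ler0n /= invf_le1 // ler1n.
by exists (Itv.mk h).
Qed.

(** Almost every curve of [eta] is a geodesic from [p] into [A], so its midpoint lies in [B]. The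
    integral over the curves that meet [B] at time [1 / 2] therefore sees the whole mass and is at
    least [c]. *)
Lemma MCP_midpoint (m : {measure set (heis R) -> \bar R}) (K N : R) (p : heis R)
    (A B : set (heis R)) (c Theta : R) :
  MCP d m K N -> spt d m p -> open A -> open B -> (0 < m A < +oo)%E -> 0 <= c ->
  (forall theta, 0 <= theta <= Theta -> (c%:E <= poweR (tau K N 2^-1 theta) N)%E) ->
  (forall q, A q -> d p q <= Theta) ->
  (forall q x, A q -> d p x = d p q / 2 -> d x q = d p q / 2 -> B x) ->
  (c%:E * m A <= m B)%E.
Proof.
move=> mcp sp oA oB mA c0 hc hA hAB.
have meA : measurable A by exact: measurable_open_heis.
have meB : measurable B by exact: measurable_open_heis.
have [eta [eta1 _ ev0 ev1 ineq]] := mcp p A sp meA mA.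
set z := 0%:i01 in ev0 ineq; set o := 1%:i01 in ev1 ineq; have [h hE] := midpoint_i01.
pose G : set curvesH := Geo d `&` (ev (dist := d) z @^-1` [set p]) `&` (ev (dist := d) o @^-1` A).
have mP : measurable (ev (dist := d) z @^-1` [set p]) by exact: measurable_ev_point.
have mO : measurable (ev (dist := d) o @^-1` A) by exact: measurable_ev_open.
have mG : measurable G.
  by apply: measurableI => //; apply: measurableI => //; exact: measurable_Geo.
have fA : m A \is a fin_num by rewrite ge0_fin_numE; case/andP: mA => // /ltW.
have fA0 : 0 < fine (m A) by rewrite fine_gt0.
have etaG : eta G = 1%E.
  apply: probability_setI1 => //; first by apply: measurableI => //; exact: measurable_Geo.
    apply: probability_setI1 => //; first exact: measurable_Geo.
    have := ev0 [set p]; rewrite /pushforward => ->.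
      by rewrite diracE mem_set.
    rewrite -[X in measurable X]setCK; apply: measurableC.
    by apply: measurable_open_heis; apply: closed_openC; exact: closed_point.
  have := ev1 A meA; rewrite /pushforward => ->.
  by rewrite setIid -{2}(fineK fA) -EFinM mulVf ?gt_eqF.
have GB g : G g -> (ev (dist := d) h @^-1` B) g /\ (c%:E <= poweR (tau K N 2^-1 (d (g z) (g o))) N)%E.
  move=> [[geo /= gz] Ao]; rewrite /ev /= in gz Ao *.
  have dz : d (g z) (g h) = `|h%:num - z%:num| * d (g z) (g o) := geo z h.
  have dh : d (g h) (g o) = `|o%:num - h%:num| * d (g z) (g o) := geo h o.
  rewrite gz in dz dh *.
  split; last by apply: hc; rewrite (d_SF_ge0 nrmN) hA.
  apply: (hAB (g o)) => //.
    by rewrite dz mulrC hE; congr (_ * _); rewrite /= subr0 ger0_norm // invr_ge0.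
  have e : (1 : R) - 2^-1 = 2^-1 by field.
  by rewrite dh mulrC hE; congr (_ * _); rewrite /= e ger0_norm // invr_ge0.
have := ineq h B meB; rewrite hE.
have : (c%:E <= \int[eta]_(g in ev (dist := d) h @^-1` B)
   poweR (tau K N 2^-1 (d (g z) (g o))) N)%E.
  apply: (@le_trans _ _ (\int[eta]_(g in ev (dist := d) h @^-1` B) ((cst c%:E) \_ G) g)%E).
    have -> : (\int[eta]_(g in ev (dist := d) h @^-1` B) ((cst c%:E) \_ G) g = \int[eta]_(g in G) cst c%:E g)%E.
      rewrite -integral_mkcondr; congr (integral _ _ _).
      by apply/seteqP; split => g; [case|move=> Gg; split => //; case: (GB g Gg)].
    have -> : (\int[eta]_(g in G) cst c%:E g = c%:E)%E.
      by rewrite -[RHS]mule1 -etaG; exact: integral_cst.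
    exact: lexx.
  apply: ge0_integral_mono => g _; rewrite patchE; case: ifPn => //.
    by rewrite inE => /GB[_].
  by move=> _; exact: poweR_ge0.
move=> h1 h2; have := le_trans h1 h2.
rewrite lee_pdivlMl //; rewrite muleC fineK //.
Qed.

End contraction.

(** * Choice of the parameters and the contradiction *)

Section small_parameters.
Context (R : realType).

Lemma exists_small (l : seq R) : {in l, forall x, 0 < x} ->
  exists2 k, 0 < k & {in l, forall x, k <= x}.
Proof.
elim: l => [|x l IH] h; first by exists 1.
have [|k k0 hk] := IH; first by move=> y yl; apply: h; rewrite inE yl orbT.
exists (Num.min x k); first by rewrite lt_min k0 h ?mem_head.
move=> y; rewrite inE => /orP[/eqP ->|/hk]; first by rewrite ge_min lexx.
by move=> ky; rewrite ge_min ky orbT.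
Qed.

(** On the source box the two thin coordinates range over [(y, 2 y)] and [(a, 2 a)]. The choice
    [y = 2 k s] makes [(2 y)^2 = 2 a s], the slope condition of the polygon in the worst case. The
    choice [a = 4 k y] makes its excess at most [k (2 y) = a / 2]. With [E = a / 2], [M = 3 y] and
    [Q = a], the midpoint estimate yields at most [16 a + (9 / 2) a / b], which is below [c]. *)
Lemma contraction_parameters (b L r e : R) : 0 < b -> 0 <= L -> 0 < r -> 0 < e ->
  exists2 k, 0 < k & [/\ k <= 1 / 16, k <= e, k * L <= r / 16, k <= r / 4 &
  forall s, 0 < s -> s <= k ->
    let y := 2 * k * s in let a := 4 * k * y in let c := (16 + 5 / b) * a in
    [/\ [/\ 4 * a <= y, 2 * y <= k / 4, 2 * a <= k & c <= k],
        [/\ b * (3 * y) <= k, a / 2 / b <= y & a / 2 <= b * y],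
        (b * (3 * y) + a / 2) * (3 * y) <= a
      & 2 * c * (2 * c) <= e * (y * a)]].
Proof.
move=> b0 L0 r0 e0; pose C := 16 + 5 / b; have C0 : 0 < C by rewrite addr_gt0 // divr_gt0.
have L4 : 0 < 1 + 4 * L by rewrite ltr_wpDr // mulr_ge0.
have C2 : 0 < C ^+ 2 by rewrite exprn_gt0.
(* In order, these bounds give: smallness against 1; [a / 2 <= b y]; the bounds on [b (3 y)] and
   [Q]; [c <= k]; errors small against [r]; smallness against [e]; the volume ratio. *)
have [k k0 hk] : exists2 k, 0 < k & {in [:: 1 / 16; b / 2; (6 * b)^-1; (8 * C)^-1;
    r / (4 * (1 + 4 * L)); e; e / (16 * C ^+ 2)], forall x, k <= x}.
  apply: exists_small => x; rewrite !inE.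
  move=> /orP[/eqP ->|/orP[/eqP ->|/orP[/eqP ->|/orP[/eqP ->|/orP[/eqP ->|/orP[/eqP ->|/eqP ->]]]]]];
    by rewrite ?divr_gt0 ?invr_gt0 ?mulr_gt0.
have k16 : k <= 1 / 16 by apply: hk; rewrite !inE eqxx.
have kb : k <= b / 2 by apply: hk; rewrite !inE eqxx ?orbT.
have k6 : k * (6 * b) <= 1.
  by rewrite -ler_pdivlMr ?mulr_gt0 // mul1r; apply: hk; rewrite !inE eqxx ?orbT.
have kC : k * (8 * C) <= 1.
  by rewrite -ler_pdivlMr ?mulr_gt0 // mul1r; apply: hk; rewrite !inE eqxx ?orbT.
have kL : k * (4 * (1 + 4 * L)) <= r.
  by rewrite -ler_pdivlMr ?mulr_gt0 //; apply: hk; rewrite !inE eqxx ?orbT.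
have ke : k <= e by apply: hk; rewrite !inE eqxx ?orbT.
have kR : k * (16 * C ^+ 2) <= e.
  by rewrite -ler_pdivlMr ?mulr_gt0 //; apply: hk; rewrite !inE eqxx ?orbT.
have kL0 : 0 <= k * L by rewrite mulr_ge0 // ltW.
have kLE : k * (4 * (1 + 4 * L)) = 4 * k + 16 * (k * L) by ring.
exists k => //; split => //; [clear -kL kLE k0; lra|clear -kL kLE kL0; lra|].
move=> s s0 sk y a c.
have y0 : 0 < y by rewrite !mulr_gt0.
have ks : k * s <= k * (1 / 16) by rewrite ler_pM2l // (le_trans sk).
have ky0 : k * y <= 1 / 16 * y by rewrite ler_pM2r.
have yks : y = 2 * (k * s) by rewrite /y mulrA.
have aky : a = 4 * (k * y) by rewrite /a mulrA.
have yk : 2 * y <= k / 4 by clear -ks yks; lra.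
have ay : 4 * a <= y by clear -ky0 aky; lra.
have ak : 2 * a <= k by clear -yk ay k0; lra.
have ks0 : 0 < k * s by exact: mulr_gt0.
have ck : c <= k.
  have -> : c = k * (8 * C) * (k * s) by rewrite /c -/C /a /y; ring.
  have : k * (8 * C) * (k * s) <= 1 * (k * s) by rewrite ler_pM2r.
  by clear -ks k0; lra.
have by6 : b * (3 * y) <= k.
  have -> : b * (3 * y) = k * (6 * b) * s by rewrite /y; ring.
  have : k * (6 * b) * s <= 1 * s by rewrite ler_pM2r.
  by clear -sk; lra.
have aby : a / 2 <= b * y.
  have : k * y <= b / 2 * y by rewrite ler_pM2r.
  by clear -aky; lra.
split => //; first by split => //; rewrite ler_pdivrMr // [y * b]mulrC.
- have y30 : 0 < 3 * y by rewrite mulr_gt0.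
  apply: (@le_trans _ _ ((b * (3 * y) + b * y) * (3 * y))).
    by rewrite ler_pM2r // lerD2l.
  have -> : (b * (3 * y) + b * y) * (3 * y) = (k * (6 * b)) * (4 * s * y) by rewrite /y; ring.
  apply: (@le_trans _ _ (1 * (4 * s * y))); first by rewrite ler_pM2r ?mulr_gt0.
  by rewrite mul1r /a ler_pM2r // ler_pM2l.
- have a0 : 0 < a by rewrite !mulr_gt0.
  have -> : 2 * c * (2 * c) = k * (16 * C ^+ 2) * (y * a) by rewrite /c -/C /a; ring.
  by rewrite ler_pM2r // mulr_gt0.
Qed.

End small_parameters.

Lemma coordinate_ratio (R : realType) (v w : R * R) (pi : R * R -> R) (u : R * R) :
  wedge v w = 1 -> coordinate pi -> pi v != 0 ->
  pi u / pi v = wedge u w + wedge v u * (pi w / pi v).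
Proof.
move=> vw cpi pv0; have piL (x y : R) : pi (x *: v + y *: w) = x * pi v + y * pi w.
  by case: cpi => ->; rewrite /= /GRing.scale /=.
by rewrite {1}(wedge_decomp u vw) piL; field.
Qed.

(* The target box is thin in the two directions transverse to v, while the
   source box is thin in one of them only: the volume ratio is at most e. *)
Lemma box_contraction (R : realType) (nrm : R * R -> R) (v w : R * R) (b : R)
    (pi : R * R -> R) (r e : R) :
  is_norm nrm -> 0 < b -> nrm v = 1 -> wedge v w = 1 ->
  (forall u, `|wedge u w| + b * `|wedge v u| <= nrm u) ->
  (forall k, 0 < k -> exists s, [/\ 0 < s, s <= k &
    nrm (v + s *: w) <= 1 + b * s + k * s]) ->
  coordinate pi -> pi v != 0 -> 0 < r -> r <= 1 / 16 -> 0 < e ->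
  exists y a c : R, let A := box pi v w (9 / 8 - r) (9 / 8 + r) y (2 * y) a (2 * a) in
    [/\ [/\ 0 < y, 0 < a & 0 < c], [/\ 2 * y <= e, 2 * a <= e & c <= e],
        2 * c * (2 * c) <= e * (y * a),
        forall q, A q -> d_SF nrm 0 q <= 3
      & forall q x, A q -> d_SF nrm 0 x = d_SF nrm 0 q / 2 ->
          d_SF nrm x q = d_SF nrm 0 q / 2 ->
          box pi v w (9 / 16 - r) (9 / 16 + r) (- c) c (- c) c x].
Proof.
move=> nrmN b0 nv vw nrm_ge kinkb cpi pv0 r0 r16 e0.
have [k k0 [k16 ke kL kr4 hk]] :=
  contraction_parameters b0 (normr_ge0 (pi w / pi v)) r0 e0.
have [s [s0 sk hs]] := kinkb k k0.
pose y := 2 * k * s; pose a := 4 * k * y; pose c := (16 + 5 / b) * a.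
have [[ay yk ak ck] [by6 aby aby'] hQ ratio] := hk s s0 sk.
rewrite -/y -/a -/c in ay yk ak ck by6 aby aby' hQ ratio.
have y0 : 0 < y by rewrite !mulr_gt0.
have a0 : 0 < a by rewrite !mulr_gt0.
have C0 : 0 < 16 + 5 / b by rewrite addr_gt0 // divr_gt0.
have c0 : 0 < c by rewrite mulr_gt0.
exists y, a, c => A.
have Afacts q : A q -> [/\ y < wedge v q.1 < 2 * y, a < area v w q < 2 * a
    & 9 / 8 - (r + r / 16) <= wedge q.1 w <= 9 / 8 + (r + r / 16)].
  move=> [[]]; rewrite !in_itv /= (coordinate_ratio _ vw) // => q12 q34 q56; split=> //.
  have : `|wedge v q.1 * (pi w / pi v)| <= r / 16.
    rewrite normrM; apply: le_trans kL; apply: ler_wpM2r => //.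
    by clear -q34 y0 yk k0; rewrite gtr0_norm; lra.
  rewrite ler_norml => /andP[h1 h2]; clear -q12 h1 h2.
  by case/andP: q12 => *; apply/andP; split; lra.
have Aby q : A q -> b * wedge v q.1 <= b * (2 * y).
  by move=> /Afacts[/andP[_ /ltW h] _ _]; rewrite ler_pM2l.
have Adist q : A q -> d_SF nrm 0 q <= wedge q.1 w + b * wedge v q.1 + a / 2.
  move=> Aq; have [/andP[h1 h2] /andP[h3 h4] /andP[h5 _]] := Afacts q Aq.
  have wy0 : 0 < wedge v q.1 by exact: lt_trans h1.
  apply: (le_trans (d_SF_polygon nrmN vw nv s0 hs wy0 (lt_trans a0 h3) _ _)).
  - apply: (@le_trans _ _ ((2 * y) ^+ 2)).
      by rewrite ler_sqr ?nnegrE ?ltW // mulr_gt0.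
    have -> : (2 * y) ^+ 2 = 2 * a * s by rewrite /a /y; ring.
    by rewrite ler_pM2r // ler_pM2l // ltW.
  - rewrite ler_pdivrMr //; apply: (@le_trans _ _ (1 * wedge v q.1)).
      by clear -h1 h4 ay; lra.
    by rewrite ler_pM2r //; clear -h5 r16; lra.
  - rewrite lerD2l; apply: (@le_trans _ _ (k * (2 * y))); first by rewrite ler_pM2l // ltW.
    by rewrite /a le_eqVlt; apply/orP; left; apply/eqP; field.
split => //.
- by clear -yk ak ck ke k0; split; lra.
- move=> q Aq; apply: (le_trans (Adist q Aq)); have := Aby q Aq.
  have [_ _ /andP[_ h]] := Afacts q Aq.
  by clear -h r16 by6 k16 ak y0 b0 aby'; lra.
move=> q x Aq x1 x2; have D := Adist q Aq; have bq := Aby q Aq.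
have [/andP[h1 h2] /andP[h3 h4] /andP[h5 h6]] := Afacts q Aq.
have byE : b * wedge v q.1 + a / 2 <= k by clear -bq by6 aby'; lra.
have [g1 g2 g3] : [/\ `|wedge x.1 w - wedge q.1 w / 2| <= (b * wedge v q.1 + a / 2) / 2,
    `|wedge v x.1| <= a / 2 / b + 4 * (`|area v w q| + 2 * (a / 2 / b) + 2 * a)
  & `|area v w x| <= `|area v w q| + 2 * (a / 2 / b) + a].
  apply: (midpoint_estimate nrmN b0 vw nrm_ge _ _ _ _ D x1 x2 _ hQ).
  - by exact: lt_trans h1.
  - by rewrite divr_ge0 // ltW.
  - by clear -h5 r16; lra.
  - by clear -h6 r16; lra.
  - by clear -h2 aby; lra.
  - by clear -byE k16; lra.
have aa : `|area v w q| <= 2 * a by rewrite gtr0_norm ?ltW // (lt_trans a0).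
have cE : c = 16 * a + 5 * (a / b) by rewrite /c mulrDl mulrAC mulrA.
have abE : a / 2 / b = a / b / 2 by rewrite mulrAC.
have ab0 : 0 < a / b by rewrite divr_gt0.
rewrite abE in g2 g3.
have yc : `|wedge v x.1| < c by clear -g2 aa cE ab0 a0; lra.
have ac : `|area v w x| < c by clear -g3 aa cE ab0 a0; lra.
split; last by rewrite in_itv /= -ltr_norml.
split; last by rewrite in_itv /= -ltr_norml.
have yl : `|wedge v x.1 * (pi w / pi v)| <= r / 16.
  rewrite normrM; apply: le_trans kL; apply: ler_wpM2r => //.
  exact: le_trans (ltW yc) ck.
rewrite in_itv /= (coordinate_ratio _ vw) //; move: yl g1; rewrite !ler_norml => /andP[l1 l2] /andP[m1 m2].
(* Halving the range of [wedge q.1 w] leaves the radius [17 r / 32]. The midpoint error, at most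
   [k / 2 <= r / 8], and the correction [r / 16] fit into the rest of [r]. *)
by clear -l1 l2 m1 m2 h5 h6 byE kr4 r0; apply/andP; split; lra.
Qed.

Theorem theorem1p8 (R : realType) (nrm : R * R -> R)
    (m : {measure set (heis R) -> \bar R}) :
  is_norm nrm -> strictly_convex_norm nrm -> ~ C1_norm nrm ->
  positive_smooth_measure m ->
  forall K N : R, 1 < N -> ~ MCP (d_SF nrm) m K N.
Proof.
move=> nrmN _ nC1 [rho [rho_smooth rho0 m_rho]] K N N1 mcp.
have rho_cont : continuous rho by move=> p; exact: (rho_smooth 0%N).
have kink : has_kink nrm by apply: contrapT => nk; apply: nC1; exact: no_kink_C1.
have [v [w [b [b0 nv vw nrm_ge kinkb]]]] := kink_normal_form nrmN kink.
have [pi [cpi pv0]] : exists pi, coordinate pi /\ pi v != 0 :> R.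
  have [v1|v1] := eqVneq v.1 0; last by exists fst; split => //; left.
  exists snd; split; first by right.
  apply/eqP => v2; have := nv; rewrite [v]surjective_pairing v1 v2 (norm0 nrmN).
  by move=> /eqP; rewrite eq_sym oner_eq0.
pose qs : heis R := ((9 / 8) *: v, 0); pose ms : heis R := ((9 / 16) *: v, 0).
(* Near [qs] the density is pinched between fixed multiples of [rho qs], and near [ms] it is bounded
   above. Passing from [m] to Lebesgue measure then costs only a constant factor, fixed before the
   boxes are chosen. *)
have near1 : nbhs qs [set q | rho qs / 2 < rho q /\ rho q < 2 * rho qs].
  have h : 0 < rho qs / 2 by rewrite divr_gt0.
  have /cvgrPdist_lt /(_ _ h) := @rho_cont qs; apply: filterS => q /=.
  by rewrite ltr_norml => /andP[? ?]; split; lra.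
have near2 : nbhs ms [set q | rho q < 2 * rho ms].
  have /cvgrPdist_lt /(_ _ (rho0 ms)) := @rho_cont ms; apply: filterS => q /=.
  by rewrite ltr_norml => /andP[? ?]; lra.
have [e1 e10 he1] := box_nbhs cpi pv0 vw near1.
have [e2 e20 he2] := box_nbhs cpi pv0 vw near2.
have [c c0 hc] := tau_half_lower K 3 N1.
have [r r0 hr] : exists2 r, 0 < r & {in [:: e1; e2; 1 / 16], forall x, r <= x}.
  by apply: exists_small => x; rewrite !inE => /or3P[] /eqP -> //; rewrite divr_gt0.
have re1 : r <= e1 by apply: hr; rewrite !inE eqxx.
have re2 : r <= e2 by apply: hr; rewrite !inE eqxx orbT.
have r16 : r <= 1 / 16 by apply: hr; rewrite !inE eqxx !orbT.
have rq0 := rho0 qs; have rm0 := rho0 ms.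
(* Up to the common factor [r y a], the measure of [B] is at most [4 e rho(ms)], while [c] times
   that of [A] is at least [c rho(qs)]. The 8 leaves a factor 2 for strictness. *)
have [e e0 he] : exists2 e, 0 < e &
    {in [:: e1 / 2; e2; c * rho qs / (8 * rho ms)], forall x, e <= x}.
  by apply: exists_small => x; rewrite !inE => /or3P[] /eqP ->; rewrite ?divr_gt0 ?mulr_gt0.
have ee1 : e <= e1 / 2 by apply: he; rewrite !inE eqxx.
have ee2 : e <= e2 by apply: he; rewrite !inE eqxx orbT.
have er : e * (4 * rho ms) < c * rho qs.
  apply: (@lt_le_trans _ _ (e * (8 * rho ms))).
    by rewrite ltr_pM2l // ltr_pM2r // ltr_nat.
  by rewrite -ler_pdivlMr ?mulr_gt0 //; apply: he; rewrite !inE eqxx !orbT.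
have [y [a [k [[y0 a0 k0] [ye ae ke] ratio Abnd Amid]]]] :=
  box_contraction nrmN b0 nv vw nrm_ge kinkb cpi pv0 r0 r16 e0.
pose A := box pi v w (9 / 8 - r) (9 / 8 + r) y (2 * y) a (2 * a); rewrite -/A in Abnd Amid.
pose B := box pi v w (9 / 16 - r) (9 / 16 + r) (- k) k (- k) k.
have oA : open A by exact: box_open.
have oB : open B by exact: box_open.
have mA : measurable A by exact: measurable_open_heis.
have mB : measurable B by exact: measurable_open_heis.
have volA : lebesgue_heis R A = (2 * r * y * a)%:E.
  rewrite /A box_volume //; [by congr EFin; ring|by clear -r0; lra|by clear -y0; lra|by clear -a0; lra].
have volB : lebesgue_heis R B = (2 * r * (2 * k) * (2 * k))%:E.
  rewrite /B box_volume //; [by congr EFin; ring|by clear -r0; lra|by clear -k0; lra|by clear -k0; lra].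
have rhoA q : A q -> rho qs / 2 < rho q /\ rho q < 2 * rho qs.
  move=> [[]]; rewrite !in_itv /= => q12 q34 q56.
  apply: he1; rewrite ltr_norml; clear -q12 q34 q56 re1 ye ae ee1 y0 a0 e10.
  - by case/andP: q12 => *; apply/andP; split; lra.
  - by case/andP: q34 => *; apply/andP; split; lra.
  - by case/andP: q56 => *; apply/andP; split; lra.
have rhoB q : B q -> rho q < 2 * rho ms.
  move=> [[]]; rewrite !in_itv /= => q12 q34 q56.
  apply: he2; rewrite ltr_norml; clear -q12 q34 q56 re2 ke ee2.
  - by case/andP: q12 => *; apply/andP; split; lra.
  - by case/andP: q34 => *; apply/andP; split; lra.
  - by case/andP: q56 => *; apply/andP; split; lra.
have r20 : 0 <= rho qs / 2 by rewrite divr_ge0 // ltW.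
have mA1 : ((rho qs / 2 * (2 * r * y * a))%:E <= m A)%E.
  rewrite EFinM -volA; apply: (density_lower rho_cont m_rho) => // q /rhoA[? _]; exact: ltW.
have mA2 : (m A <= (2 * rho qs * (2 * r * y * a))%:E)%E.
  rewrite EFinM -volA; apply: (density_upper rho_cont rho0 m_rho) => // q /rhoA[_ ?]; exact: ltW.
have mB1 : (m B <= (2 * rho ms * (2 * r * (2 * k) * (2 * k)))%:E)%E.
  rewrite EFinM -volB; apply: (density_upper rho_cont rho0 m_rho) => // q /rhoB ?; exact: ltW.
have mA0 : (0 < m A < +oo)%E.
  apply/andP; split; last exact: le_lt_trans mA2 (ltry _).
  by apply: lt_le_trans mA1; rewrite lte_fin !mulr_gt0.
have spt0 : spt (d_SF nrm) m 0.
  move=> l l0.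
  have ob : open [set q | d_SF nrm 0 q < l] by exact: d_SF_ball_open.
  apply: (density_open_gt0 rho_cont rho0 m_rho (p := 0)).
    exact: measurable_open_heis.
  exact: d_SF_near.
have := MCP_midpoint nrmN b0 vw nrm_ge mcp spt0 oA oB mA0 (ltW c0) hc Abnd Amid.
apply/negP; rewrite -ltNge; apply: (le_lt_trans mB1).
apply: (@lt_le_trans _ _ (c%:E * (rho qs / 2 * (2 * r * y * a))%:E)%E); last first.
  by apply: lee_wpmul2l => //; rewrite lee_fin ltW.
rewrite -EFinM lte_fin.
have -> : 2 * rho ms * (2 * r * (2 * k) * (2 * k)) = 4 * rho ms * r * (2 * k * (2 * k)) by ring.
have -> : c * (rho qs / 2 * (2 * r * y * a)) = c * rho qs * (r * (y * a)) by field.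
have rya : 0 < r * (y * a) by rewrite !mulr_gt0.
apply: (@le_lt_trans _ _ (4 * rho ms * r * (e * (y * a)))).
  by rewrite ler_pM2l // !mulr_gt0.
have -> : 4 * rho ms * r * (e * (y * a)) = e * (4 * rho ms) * (r * (y * a)) by ring.
rewrite ltr_pM2r //.
Qed.
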